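(* Let $M=\begin{pmatrix}a&b\\c&d\end{pmatrix}\in\mathrm{Sp}(n,\mathbb{R})$, $\lambda,\mu\in M(1,n,\mathbb{R})$, $\kappa\in\mathbb{R}$. a) The action of $G^J_n(\mathbb{R})_0$ on $\mathcal{X}^J_n$, $(M,(\lambda,\mu))\times(v',u')\to(v_1,u_1)$, is given by $$v_1=(av'+b)(cv'+d)^{-1}=(v'c^t+d^t)^{-1}(v'a^t+b^t),\qquad u_1=(u'+\lambda v'+\mu)(cv'+d)^{-1}.$$ With $v'=x'+iy'$, $v_1$ has the equivalent expressions $$\begin{aligned}v_1=\;&\big[c(y'+x'y'^{-1}x')c^t+dy'^{-1}d^t+cx'y'^{-1}d^t+dy'^{-1}x'c^t\big]^{-1}\\&\times\big[c(y'+x'y'^{-1}x')a^t+cx'y'^{-1}b^t+dy'^{-1}x'a^t+dy'^{-1}b^t+i\,1_n\big]\end{aligned}$$ and $$v_1=(\bar v'c^t+d^t)^{-1}\Big(\tfrac{B}{2}+iy'\Big)(cv'+d)^{-1},\quad B=2\bar v'a^tcv'+\bar v'(c^tb+a^td)+(b^tc+d^ta)v'+2b^td.$$ b) Let $(p,q)$ be defined by $$(p,q)=(\lambda,\mu)M^{-1}=(\lambda d^t-\mu c^t,\,-\lambda b^t+\mu a^t),\qquad\text{i.e. } (\lambda,\mu)=(p,q)M=(pa+qc,\,pb+qd).$$ Then, in the coordinates $(x,y,p,q)$, the action of $G^J_n(\mathbb{R})_0$ on $\mathcal{X}^J_n$, $(M,(\lambda,\mu))\times(x',y',p',q')\to(x_1,y_1,p_1,q_1)$,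 is given by $x_1+iy_1=v_1$ with $v_1$ as in a), and $$(p_1,q_1)=(p,q)+(p',q')\begin{pmatrix}a&b\\c&d\end{pmatrix}^{-1}=(p+p'd^t-q'c^t,\;q-p'b^t+q'a^t).$$ c) The action of $G^J_n(\mathbb{R})$ on $\tilde{\mathcal{X}}^J_n\approx\mathcal{X}^J_n\times\mathbb{R}$, $(M,(\lambda,\mu),\kappa)\times(v',u',\kappa')\to(v_1,u_1,\kappa_1)$, respectively $(M,(\lambda,\mu),\kappa)\times(x',y',p',q',\kappa')\to(x_1,y_1,p_1,q_1,\kappa_1)$, is given by the formulas in a) and b), together with $$\kappa_1=\kappa+\kappa'+\lambda q'^t-\mu p'^t.$$ d) The one-form $$\lambda^R=d\kappa-p\,dq^t+q\,dp^t$$ on $\tilde{\mathcal{X}}^J_n$ (coordinates $(x,y,p,q,\kappa)$) is invariant under the action of $G^J_n(\mathbb{R})$ on $\tilde{\mathcal{X}}^J_n$ in c). e) In the $S_n$-coordinates, the action of $G^J_n(\mathbb{R})$ on itself by left multiplication, $(M,(\lambda,\mu),\kappa)\times(x',y',X',Y',p',q',\kappa')\to(x_1,y_1,X_1,Y_1,p_1,q_1,\kappa_1)$, is given by $$X_1-iY_1=y_1^{1/2}\Big\{(cx'+d)y'^{-1/2}X'+cy'^{1/2}Y'+i\big[cy'^{1/2}X'-(cx'+d)y'^{-1/2}Y'\big]\Big\},$$ while $x_1,y_1,p_1,q_1,\kappa_1$ are given by the formulas in a), b), c).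
   Context: $M(m,n,\mathbb{F})$ is the set of $m\times n$ matrices over $\mathbb{F}$; $A^t$ is the transpose. $\mathrm{Sp}(n,\mathbb{R})$ is the group of real $2n\times2n$ matrices $M=\begin{pmatrix}a&b\\c&d\end{pmatrix}$ with $M^tJM=J$, $J=\begin{pmatrix}0&1_n\\-1_n&0\end{pmatrix}$. Real Jacobi group: $G^J_n(\mathbb{R})$ is the set of triples $(M,(\lambda,\mu),\kappa)$, $M\in\mathrm{Sp}(n,\mathbb{R})$, $\lambda,\mu\in M(1,n,\mathbb{R})$, $\kappa\in\mathbb{R}$, with composition law $(M,(\lambda,\mu),\kappa)(M',(\lambda',\mu'),\kappa')=(MM',(\tilde\lambda+\lambda',\tilde\mu+\mu'),\kappa+\kappa'+\tilde\lambda\mu'^t-\tilde\mu\lambda'^t)$, where $(\tilde\lambda,\tilde\mu)=(\lambda,\mu)M'$. The restricted group $G^J_n(\mathbb{R})_0$ consists of the pairs $(M,(\lambda,\mu))$ with the law obtained by forgetting $\kappa$. Siegel upper half space: $\mathcal{X}_n=\{v=x+iy: x,y\in M(n,n,\mathbb{R}),\ x=x^t,\ y=y^t,\ y>0\}$. Siegel-Jacobi upper half space: $\mathcal{X}^J_n=G^J_n(\mathbb{R})/(\mathrm{U}(n)\times\mathbb{R})$, realized as the set of pairs $(v,u)$, $v\in\mathcal{X}_n$, $u\in M(1,n,\mathbb{C})$; the coset of $(M,(\lambda,\mu),\kappa)$ corresponds to the image of the base point $(i\,1_n,0)$. Extended Siegel-Jacobi upper half space: $\tilde{\mathcal{X}}^J_n=G^J_n(\mathbb{R})/\mathrm{U}(n)$,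 realized as the set of triples $(v,u,\kappa)$ with $(v,u)\in\mathcal{X}^J_n$, $\kappa\in\mathbb{R}$, with base point $(i\,1_n,0,0)$. The actions are those induced by left multiplication. The real coordinates $(x,y,p,q)$ on $\mathcal{X}^J_n$ are defined by $v=x+iy$, $u=pv+q$, $p,q\in M(1,n,\mathbb{R})$ (and similarly with primes or index 1). $S_n$-coordinates on $G^J_n(\mathbb{R})$: the element $(M,(\lambda,\mu),\kappa)$ has coordinates $(x,y,X,Y,p,q,\kappa)$, where $(p,q)=(\lambda,\mu)M^{-1}$ and $(x,y,X,Y)$ are the modified pre-Iwasawa parameters of $M=\begin{pmatrix}a&b\\c&d\end{pmatrix}$: $y=(dd^t+cc^t)^{-1}$, $x=y(db^t+ca^t)$, $X-iY=y^{1/2}(d+ic)$ with $X,Y$ real; equivalently $a=y^{1/2}X-xy^{-1/2}Y$, $b=y^{1/2}Y+xy^{-1/2}X$, $c=-y^{-1/2}Y$, $d=y^{-1/2}X$, where $x=x^t$, $y=y^t>0$, $X+iY\in\mathrm{U}(n)$. Powers of symmetric positive definite matrices are the symmetric positive definite ones. *)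

(* Defs.v *)
From HB Require Import structures.
From mathcomp Require Import all_boot all_order all_algebra.
From mathcomp Require Import complex.
From mathcomp Require Import all_classical all_reals all_analysis.
Set Implicit Arguments.
Unset Strict Implicit.
Unset Printing Implicit Defensive.
Import Order.TTheory GRing.Theory Num.Theory numFieldNormedType.Exports.
Local Open Scope classical_set_scope.
Local Open Scope ring_scope.

(* MathComp / MathComp-Analysis: the real numbers are any R : realType, the
   complex numbers are R[i]; real 2n x 2n matrices are 'M[R]_(n + n). *)

Section Matrices.
Context {R : realType}.

Definition toC m n (A : 'M[R]_(m, n)) : 'M[R[i]]_(m, n) :=
  map_mx (real_complex R) A.

(* x + i y *)
Definition cplx m n (x y : 'M[R]_(m, n)) : 'M[R[i]]_(m, n) :=
  \matrix_(j, k) Complex (x j k) (y j k).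

Definition cconjmx m n (A : 'M[R[i]]_(m, n)) : 'M[R[i]]_(m, n) :=
  map_mx Num.conj A.

Definition spd n (y : 'M[R]_n) : Prop :=
  y^T = y /\ forall w : 'rV[R]_n, w != 0 -> 0 < (w *m y *m w^T) 0 0.

(* The symmetric positive definite y^{1/2} for y symmetric positive definite
   (junk value otherwise). *)
Definition mxsqrt n (y : 'M[R]_n) : 'M[R]_n :=
  xget 0 [set s | spd s /\ s *m s = y].

Definition siegel n : set 'M[R[i]]_n :=
  [set v | exists x y, [/\ v = cplx x y, x^T = x & spd y]].

Definition symplectic_form n : 'M[R]_(n + n) := block_mx 0 1%:M (- 1%:M) 0.

Definition symplectic n : set 'M[R]_(n + n) :=
  [set M | M^T *m symplectic_form n *m M = symplectic_form n].

(* U(n) as a subgroup of Sp(n, R) *)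
Definition unitary_sp n : set 'M[R]_(n + n) :=
  [set M | exists X Y : 'M[R]_n,
     cplx X Y \is unitarymx /\ M = block_mx X Y (- Y) X].

End Matrices.

(* Triples (M, (lambda, mu), kappa); the group is the subset GJ below. *)
Record jacobi (R : realType) (n : nat) := Jacobi {
  jM : 'M[R]_(n + n);
  jlambda : 'rV[R]_n;
  jmu : 'rV[R]_n;
  jkappa : R }.

Section JacobiGroup.
Context {R : realType} {n : nat}.
Implicit Types (g h : jacobi R n) (K C : set (jacobi R n)).

Definition GJ : set (jacobi R n) := [set g | symplectic (jM g)].

Definition mulJ g h : jacobi R n :=
  let w := row_mx (jlambda g) (jmu g) *m jM h in
  Jacobi (jM g *m jM h) (lsubmx w + jlambda h) (rsubmx w + jmu h)
    (jkappa g + jkappa h + (lsubmx w *m (jmu h)^T) 0 0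
                         - (rsubmx w *m (jlambda h)^T) 0 0).

Definition UnR : set (jacobi R n) :=
  [set g | [/\ unitary_sp (jM g), jlambda g = 0 & jmu g = 0]].

Definition Un : set (jacobi R n) := UnR `&` [set g | jkappa g = 0].

(* Modified pre-Iwasawa parameters (x, y, X, Y) of M = (a, b; c, d).  X and Y
   are the real matrices with X - i Y = y^{1/2} (d + i c). *)
Definition iw_y (M : 'M[R]_(n + n)) : 'M[R]_n :=
  let c := dlsubmx M in let d := drsubmx M in
  invmx (d *m d^T + c *m c^T).

Definition iw_x (M : 'M[R]_(n + n)) : 'M[R]_n :=
  let a := ulsubmx M in let b := ursubmx M in
  let c := dlsubmx M in let d := drsubmx M in
  iw_y M *m (d *m b^T + c *m a^T).

Definition iw_X (M : 'M[R]_(n + n)) : 'M[R]_n := mxsqrt (iw_y M) *m drsubmx M.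
Definition iw_Y (M : 'M[R]_(n + n)) : 'M[R]_n :=
  - (mxsqrt (iw_y M) *m dlsubmx M).

(* (p, q) = (lambda, mu) M^{-1} *)
Definition jp g : 'rV[R]_n :=
  lsubmx (row_mx (jlambda g) (jmu g) *m invmx (jM g)).
Definition jq g : 'rV[R]_n :=
  rsubmx (row_mx (jlambda g) (jmu g) *m invmx (jM g)).

(* S_n-coordinates (x, y, X, Y, p, q, kappa) *)
Definition Sn_coords g :
    'M[R]_n * 'M[R]_n * 'M[R]_n * 'M[R]_n * 'rV[R]_n * 'rV[R]_n * R :=
  (iw_x (jM g), iw_y (jM g), iw_X (jM g), iw_Y (jM g), jp g, jq g, jkappa g).

(* Points of the Siegel-Jacobi space, resp. of the extended one, with real
   coordinates (x, y, p, q), resp. (x, y, p, q, kappa). *)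
Definition SJ_chart (x y : 'M[R]_n) (p q : 'rV[R]_n) :
    'M[R[i]]_n * 'rV[R[i]]_n :=
  (cplx x y, toC p *m cplx x y + toC q).

Definition ext_coords : Type :=
  ('M[R]_n * 'M[R]_n * 'rV[R]_n * 'rV[R]_n * R)%type.

Definition extSJ_chart (m : ext_coords) : 'M[R[i]]_n * 'rV[R[i]]_n * R :=
  let: (x, y, p, q, k) := m in (SJ_chart x y p q, k).

(* The points (v, u) and (v, u, kappa) realizing the cosets g (U(n) x R) and
   g U(n): only the coordinates X, Y (and kappa) of g are forgotten.  The coset
   of the identity is realized by the base point (i 1_n, 0), resp.
   (i 1_n, 0, 0). *)
Definition SJ_point g : 'M[R[i]]_n * 'rV[R[i]]_n :=
  SJ_chart (iw_x (jM g)) (iw_y (jM g)) (jp g) (jq g).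

Definition extSJ_point g : 'M[R[i]]_n * 'rV[R[i]]_n * R :=
  (SJ_point g, jkappa g).

(* [realizes K pt C m]: C is a left coset g K of GJ / K, and m = pt g. *)
Definition realizes (P : Type) K (pt : jacobi R n -> P) C (m : P) : Prop :=
  exists g, [/\ GJ g, C = [set mulJ g k | k in K] & m = pt g].

(* Left multiplication by g on GJ / K, read on realizations: m is mapped to m1
   when m realizes a coset C and m1 realizes g C.  It is a relation because
   single-valuedness on points is not part of the definition. *)
Definition coset_action (P : Type) K (pt : jacobi R n -> P) g (m m1 : P) :
    Prop :=
  exists C, realizes K pt C m /\ realizes K pt [set mulJ g h | h in C] m1.

(* The restricted group is GJ modulo the centre {(1, (0, 0), kappa)}; an
   element (M, (lambda, mu)) acts on GJ / (U(n) x R) through any lift. *)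
Definition SJ_action0 (M : 'M[R]_(n + n)) (lambda mu : 'rV[R]_n) m m1 : Prop :=
  exists kappa, coset_action UnR SJ_point (Jacobi M lambda mu kappa) m m1.

Definition extSJ_action g m m1 : Prop := coset_action Un extSJ_point g m m1.

(* The coordinate domain of the extended Siegel-Jacobi space in the vector
   space ext_coords.  It is open in the subspace of those (x, y, p, q, kappa)
   with x, y symmetric, which is its tangent space at every point. *)
Definition ext_domain : set ext_coords :=
  [set m | let: (x, y, _, _, _) := m in x^T = x /\ spd y].

Definition ext_tangent : set ext_coords :=
  [set w | let: (dx, dy, _, _, _) := w in dx^T = dx /\ dy^T = dy].

(* The action of g in the coordinates (x, y, p, q, kappa). *)
Definition extSJ_map g (m : ext_coords) : ext_coords :=
  xget m [set m1 | extSJ_action g (extSJ_chart m) (extSJ_chart m1)].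

(* d kappa - p dq^t + q dp^t at the point m, on the tangent vector w *)
Definition lambdaR (m w : ext_coords) : R :=
  let: (_, _, p, q, _) := m in
  let: (_, _, dp, dq, dk) := w in
  dk - (p *m dq^T) 0 0 + (q *m dp^T) 0 0.

(* f^* omega = omega on ext_domain, the differential of f at m on a tangent
   vector w being the derivative of t |-> f (m + t w) at 0. *)
Definition invariant_form (omega : ext_coords -> ext_coords -> R)
    (f : ext_coords -> ext_coords) : Prop :=
  forall m w, ext_domain m -> ext_tangent w ->
    derivable f m w /\ omega (f m) ('D_w f m) = omega m w.

End JacobiGroup.

(* Main.v *)
Require Import Defs.
From HB Require Import structures.
From mathcomp Require Import all_boot all_order all_algebra.
From mathcomp Require Import complex.
From mathcomp Require Import all_classical all_reals all_analysis.
From mathcomp Require Import ring lra.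
Set Implicit Arguments.
Unset Strict Implicit.
Unset Printing Implicit Defensive.
Import Order.TTheory GRing.Theory Num.Theory numFieldNormedType.Exports.
Local Open Scope classical_set_scope.
Local Open Scope ring_scope.

(* For M = (a, b; c, d) in Sp(n, R), the point with pre-Iwasawa coordinates
   x + i y is characterized by (x + i y)(c i + d) = a i + b, and every point of
   X_n arises in this way, from (s, x s^-1; 0, s^-1) with s = y^{1/2}.  So the
   action on X_n is read off the product of block matrices.  In the remaining
   coordinates, (p, q) = (lambda, mu) M^-1 turns the group law into
   (p, q) + (p', q') M^-1, and kappa gains the symplectic product of (lambda, mu)
   and (p', q').  As lambda^R = d kappa - <(p, q), (dp, dq)> for the symplectic
   form <_, _>, Sp-invariance of that form gives d).

   Differentiability in d) is checked along lines, where the image point is given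
   by the real rational expressions y1 = D^-1 and x1 = D^-1 N of a). *)

(** The action is given as a relation between realizations of cosets. It becomes a function once the
    realization is constant on each coset and the point of g h is seen to depend on h only through
    the point of h; the explicit map [ext_map] supplies the second fact. All invertibility is
    inherited from the base point. If v is the point of N, with bottom row (c', d'), then (c v +
    d)(c' i + d') is the automorphy factor of M N at i, and at i the question is settled by d d^t +
    c c^t > 0. The remaining obstacle is y^{1/2}, which [mxsqrt] picks from a set that has to be
    shown nonempty. Diagonalization takes place over the complex numbers, whereas the root must be
    real and symmetric. A real polynomial in y is both, which is why interpolation at the
    eigenvalues enters. *)

Lemma poly_interpolation (F : fieldType) (s : seq F) (f : F -> F) :
  exists p : {poly F}, {in s, forall x, p.[x] = f x}.
Proof.
elim: s => [|x s [p pP]]; first by exists 0.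
(* Nodes may repeat, as eigenvalues do. *)
have [xs|xs] := boolP (x \in s).
  by exists p => z; rewrite inE => /predU1P[->|/pP//]; exact: pP.
(* Newton's correction: w vanishes at the earlier nodes and not at the new node x. *)
pose w := \prod_(z <- s) ('X - z%:P); exists (p + ((f x - p.[x]) / w.[x]) *: w) => z.
have wx0 : w.[x] != 0 by move: xs; rewrite -root_prod_XsubC rootE.
rewrite inE hornerD hornerZ => /predU1P[->|zs].
  by rewrite divfK// addrC subrK.
have /eqP-> : w.[z] == 0 by rewrite -rootE root_prod_XsubC.
by rewrite mulr0 addr0 pP.
Qed.

(** * Positive definite real matrices, complexification, square roots *)

Section RealMatrices.
Context {R : realType}.

Lemma rv_sqnormE (F : pzRingType) n (w : 'rV[F]_n) : (w *m w^T) 0 0 = \sum_i w 0 i ^+ 2.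
Proof. by rewrite mxE; apply: eq_bigr => i _; rewrite mxE expr2. Qed.

Lemma rv_sqnorm_gt0 n (w : 'rV[R]_n) : w != 0 -> 0 < (w *m w^T) 0 0.
Proof.
move=> /rV0Pn[i wi]; rewrite rv_sqnormE lt0r sumr_ge0 ?andbT => [|j _]; last exact: sqr_ge0.
rewrite psumr_eq0 => [|j _]; last exact: sqr_ge0.
by apply/allPn; exists i; rewrite ?mem_index_enum// sqrf_eq0.
Qed.

Lemma spd_unitmx n (y : 'M[R]_n) : spd y -> y \in unitmx.
Proof.
move=> [_ ypos]; rewrite -row_free_unit -kermx_eq0; apply/rowV0P => w /sub_kermxP wy.
by apply/eqP; apply: contraT => /ypos; rewrite wy mul0mx mxE ltxx.
Qed.

Lemma spd_gram n (t : 'M[R]_n) : t \in unitmx -> spd (t *m t^T).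
Proof.
move=> ut; split=> [|w w0]; first by rewrite trmx_mul trmxK.
rewrite -mulmxA -(mulmxA t) -trmx_mul mulmxA rv_sqnorm_gt0//.
by apply: contra w0 => /eqP wt; rewrite -(mulmxK ut w) wt mul0mx.
Qed.

Lemma spd_inv n (y : 'M[R]_n) : spd y -> spd (invmx y).
Proof.
move=> sy; have uy := spd_unitmx sy; have [ysym ypos] := sy.
split=> [|w w0]; first by rewrite trmx_inv ysym.
have := ypos (w *m invmx y); rewrite mulmxKV// trmx_mul trmx_inv ysym mulmxA; apply.
by apply: contra w0 => /eqP wy; rewrite -(mulmxKV uy w) wy mul0mx.
Qed.

Lemma spd_congr n (t y : 'M[R]_n) : t \in unitmx -> spd y -> spd (t *m y *m t^T).
Proof.
move=> ut [ysym ypos]; split=> [|w w0]; first by rewrite !trmx_mul trmxK ysym mulmxA.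
have := ypos (w *m t); rewrite trmx_mul !mulmxA; apply.
by apply: contra w0 => /eqP wt; rewrite -(mulmxK ut w) wt mul0mx.
Qed.

Lemma horner_mx_sym n (y : 'M[R]_n.+1) (p : {poly R}) :
  y^T = y -> (horner_mx y p)^T = horner_mx y p.
Proof.
move=> ysym; elim/poly_ind: p => [|p c IH]; first by rewrite rmorph0 trmx0.
rewrite rmorphD rmorphM /= horner_mx_X horner_mx_C linearD /= tr_scalar_mx.
rewrite -[X in X^T]/(_ *m _) trmx_mul IH ysym.
by congr (_ + _); apply: (comm_mx_horner p (comm_mx_refl y)).
Qed.

Lemma toCE m n (x : 'M[R]_(m, n)) : toC x = cplx x 0.
Proof. by apply/matrixP => i j; rewrite !mxE. Qed.

Lemma cplxD m n (x y z w : 'M[R]_(m, n)) :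
  cplx x y + cplx z w = cplx (x + z) (y + w).
Proof. by apply/matrixP => i j; rewrite !mxE. Qed.

Lemma cplxZ m n (a : R) (x y : 'M[R]_(m, n)) :
  (a%:C)%C *: cplx x y = cplx (a *: x) (a *: y).
Proof.
by apply/matrixP => i j; rewrite !mxE; congr Complex; ring.
Qed.

Lemma cplx_sum (I : finType) (F G : I -> R) :
  \sum_k Complex (F k) (G k) = Complex (\sum_k F k) (\sum_k G k).
Proof. by elim/big_rec3: _ => // k u v w _ ->. Qed.

Lemma cplxM m n r (x y : 'M[R]_(m, n)) (z w : 'M[R]_(n, r)) :
  cplx x y *m cplx z w = cplx (x *m z - y *m w) (x *m w + y *m z).
Proof.
apply/matrixP => i j; rewrite !mxE -sumrN -!big_split /= -cplx_sum.
by apply: eq_bigr => k _; rewrite !mxE.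
Qed.

Lemma cplxT m n (x y : 'M[R]_(m, n)) : (cplx x y)^T = cplx x^T y^T.
Proof. by apply/matrixP => i j; rewrite !mxE. Qed.

Lemma cplx_conj m n (x y : 'M[R]_(m, n)) : cconjmx (cplx x y) = cplx x (- y).
Proof. by apply/matrixP => i j; rewrite !mxE. Qed.

Lemma cplx_inj m n (x y z w : 'M[R]_(m, n)) :
  cplx x y = cplx z w -> x = z /\ y = w.
Proof.
by move=> /matrixP e; split; apply/matrixP => i j; have := e i j; rewrite !mxE => -[].
Qed.

Lemma cplx_surj m n (v : 'M[R[i]]_(m, n)) : exists x y, v = cplx x y.
Proof.
exists (map_mx (@complex.Re R) v), (map_mx (@complex.Im R) v).
by apply/matrixP => i j; rewrite !mxE; case: (v i j).
Qed.

Lemma scale_i_toC m n (x : 'M[R]_(m, n)) : ('i%C : R[i]) *: toC x = cplx 0 x.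
Proof.
by apply/matrixP => i j; rewrite !mxE; congr Complex; ring.
Qed.

(* Left eigenvectors of the complexification split into real ones. *)
Lemma spd_spectral n (y : 'M[R]_n) : spd y ->
  exists (P : 'M[R[i]]_n) (l : 'rV[R]_n), [/\ P \in unitmx,
    toC y = invmx P *m diag_mx (toC l) *m P & forall j, 0 < l 0 j].
Proof.
move=> [ysym ypos].
have herm : toC y \is hermsymmx.
  apply: realsym_hermsym.
    apply/is_hermitianmxP; rewrite expr0 scale1r.
    by apply/matrixP => j k; rewrite !mxE /= -{1}ysym mxE.
  by apply/mxOverP => j k; rewrite mxE; apply/complex_realP; exists (y j k).
have /orthomx_spectralP yE := hermitian_normalmx herm.
have uP := spectral_unit (toC y).
have /mxOverP Dr := hermitian_spectral_diag_real herm.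
set P := spectralmx _ in yE uP; set D := spectral_diag _ in yE Dr.
pose l : 'rV[R]_n := \row_j complex.Re (D 0 j).
have DE : D = toC l by apply/rowP => j; rewrite !mxE RRe_real.
exists P, l; rewrite -DE; split=> // j.
have eigP : row j P *m toC y = D 0 j *: row j P.
  by rewrite yE !mulmxA -!row_mul mulmxV// mul1mx mul_diag_mx; apply/rowP=> k; rewrite !mxE.
have rP0 : row j P != 0.
  apply: contraTneq (oner_neq0 R[i]) => rP0.
  have /rowP/(_ j) : row j P *m invmx P = 0 by rewrite rP0 mul0mx.
  by rewrite -row_mul mulmxV// !mxE eqxx mulr1n => ->; rewrite eqxx.
have pos (w : 'rV[R]_n) : w != 0 -> w *m y = l 0 j *: w -> 0 < l 0 j.
  move=> w0 we; have := ypos _ w0; rewrite we -scalemxAl mxE pmulr_lgt0//.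
  exact: rv_sqnorm_gt0.
have [p [q rE]] := cplx_surj (row j P).
move: eigP rP0; rewrite rE DE [toC l _ _]mxE toCE cplxM cplxZ !mulmx0 subr0 add0r.
move=> /cplx_inj[pe qe]; have [p0|/pos/(_ pe)//] := eqVneq p 0.
have [q0|/pos/(_ qe)//] := eqVneq q 0.
by rewrite p0 q0 -toCE [toC _]map_mx0 eqxx.
Qed.

(* With y = P^-1 diag(l) P and t a real polynomial such that t(l_j)^4 = l_j, the
   matrix s = t(y)^2 is a square root of y and the Gram matrix of t(y). *)
Lemma spd_sqrt_exists n (y : 'M[R]_n) : spd y -> exists s, spd s /\ s *m s = y.
Proof.
case: n y => [|n] y sy.
  by exists y; split=> //; apply/matrixP => -[].
have [P [l [uP yE lpos]]] := spd_spectral sy; have [ysym _] := sy.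
have [t tP] := poly_interpolation [seq l 0 j | j in 'I_n.+1] (fun x => Num.sqrt (Num.sqrt x)).
have tl j : (t ^+ 4).[l 0 j] = l 0 j.
  rewrite horner_exp tP ?map_f ?mem_enum// (exprM _ 2 2).
  by rewrite !sqr_sqrtr ?sqrtr_ge0// ltW.
have t4 : horner_mx y (t ^+ 4) = y.
  apply: (map_mx_inj (f := real_complex R)); rewrite -!/(toC _) [LHS]map_horner_mx.
  rewrite -/(toC y) {1}yE.
  rewrite horner_mx_uconjC// horner_mx_diag [RHS]yE; congr (_ *m diag_mx _ *m _).
  by apply/rowP => j; rewrite !mxE horner_map tl.
pose T := horner_mx y t.
have TT : T^T = T by exact: horner_mx_sym.
have T4 : (T *m T) *m (T *m T) = y.
  by rewrite -[RHS]t4 rmorphXn /= mulmxE -/T -!expr2 -exprM.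
exists (T *m T); split=> //; rewrite -{2}TT; apply: spd_gram.
by have := spd_unitmx sy; rewrite -T4 !unitmx_mul => /andP[/andP[]].
Qed.

Lemma mxsqrtP n (y : 'M[R]_n) : spd y -> spd (mxsqrt y) /\ mxsqrt y *m mxsqrt y = y.
Proof. by move=> /spd_sqrt_exists[s sP]; rewrite /mxsqrt; case: xgetP => [z _|/(_ s)]. Qed.

End RealMatrices.

Lemma addmxE (V : nmodType) m n (A B : 'M[V]_(m, n)) i j : (A + B) i j = A i j + B i j.
Proof. by rewrite mxE. Qed.

Lemma oppmxE (V : zmodType) m n (A : 'M[V]_(m, n)) i j : (- A) i j = - A i j.
Proof. by rewrite mxE. Qed.

Lemma trmxD (V : nmodType) m n (A B : 'M[V]_(m, n)) : (A + B)^T = A^T + B^T.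
Proof. by apply/matrixP => i j; rewrite !mxE. Qed.

Lemma trmxN (V : zmodType) m n (A : 'M[V]_(m, n)) : (- A)^T = - A^T.
Proof. by apply/matrixP => i j; rewrite !mxE. Qed.

Lemma scalemxE (V : pzRingType) m n (A : 'M[V]_(m, n)) k i j : (k *: A) i j = k * A i j.
Proof. by rewrite mxE. Qed.

(** Rectangular matrices form no ring, so additive identities are checked entrywise, with the
    entries of products as atoms for [ring]. *)
Ltac mxabel := apply/matrixP => ? ?; rewrite !(addmxE, oppmxE); ring.

Lemma invmx_eq (F : comUnitRingType) m (A B : 'M[F]_m) : A *m B = 1%:M -> invmx A = B.
Proof. by move=> AB; have [uA _] := mulmx1_unit AB; rewrite -(mulKmx uA B) AB mulmx1. Qed.

(** * Symplectic block relations and the action on the Siegel space *)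

Section Symplectic.
Context {R : realType} {n : nat}.
Implicit Types (a b c d x y : 'M[R]_n) (M N : 'M[R]_(n + n)).

(** M^t J M is antisymmetric, so its lower left block carries the same condition as the upper right
    one, and three equations remain. *)
Lemma symplectic_blockP a b c d : symplectic (block_mx a b c d) <->
  [/\ a^T *m c = c^T *m a, a^T *m d = 1%:M + c^T *m b & b^T *m d = d^T *m b].
Proof.
rewrite /symplectic /= /symplectic_form tr_block_mx !mulmx_block.
rewrite !mulmx0 !mulmx1 !mulmxN !mulmx1 !add0r !addr0 !mulNmx.
split=> [/eq_block_mx[e1 e2 _ e4]|[-> e2 ->]].
  split; [| by rewrite -e2 addrC addNKr |];
    by apply/eqP; rewrite -subr_eq0 addrC ?e1 ?e4.
rewrite e2 !addNr addrC addrK; congr block_mx.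
by have /(congr1 trmx) := e2; rewrite trmxD !trmx_mul !trmxK trmx1 => ->; mxabel.
Qed.

Lemma symplectic_formK : symplectic_form n *m symplectic_form n = - 1%:M :> 'M[R]_(n + n).
Proof.
rewrite /symplectic_form mulmx_block !(mulmx0, mul0mx, mul1mx, mulmx1, add0r, addr0).
by rewrite scalar_mx_block opp_block_mx !oppr0.
Qed.

Lemma symplectic_mulVmx M : symplectic M ->
  (- (symplectic_form n *m M^T *m symplectic_form n)) *m M = 1%:M.
Proof.
by move=> sM; rewrite mulNmx -!mulmxA [M^T *m _]mulmxA sM symplectic_formK opprK.
Qed.

Lemma symplectic_unitmx M : symplectic M -> M \in unitmx.
Proof. by move=> /symplectic_mulVmx/mulmx1_unit[]. Qed.

Lemma symplectic_invmx M : symplectic M ->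
  invmx M = - (symplectic_form n *m M^T *m symplectic_form n).
Proof.
move=> sM; have uM := symplectic_unitmx sM.
by rewrite -[LHS]mul1mx -(symplectic_mulVmx sM) mulmxK.
Qed.

(** The left inverse -J M^t J of M is also a right inverse; multiplying M (-J M^t J) = 1 by J on the
    right gives M J M^t = J. *)
Lemma symplectic_tr M : symplectic M -> symplectic M^T.
Proof.
move=> sM; have := symplectic_invmx sM => iM.
have : M *m invmx M = 1%:M by rewrite mulmxV// symplectic_unitmx.
rewrite iM mulmxN !mulmxA => /(congr1 (mulmx^~ (symplectic_form n))).
rewrite /symplectic /= trmxK mulNmx -!mulmxA symplectic_formK !mulmxN mulmx1 opprK.
by rewrite !mulmxA mul1mx.
Qed.

Lemma symplectic_mul M N : symplectic M -> symplectic N -> symplectic (M *m N).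
Proof.
rewrite /symplectic /= => sM sN.
by rewrite trmx_mul -!mulmxA (mulmxA M^T) (mulmxA _ M) sM mulmxA.
Qed.

Lemma symplectic_invmx_block a b c d : symplectic (block_mx a b c d) ->
  invmx (block_mx a b c d) = block_mx d^T (- b^T) (- c^T) a^T.
Proof.
move=> /symplectic_invmx->; rewrite tr_block_mx /symplectic_form !mulmx_block.
rewrite !(mulmx0, mul0mx, mul1mx, mulmx1, add0r, addr0, mulmxN, mulNmx, opprK).
by rewrite opp_block_mx !opprK.
Qed.

Lemma symplectic_tr_blockP a b c d : symplectic (block_mx a b c d) ->
  [/\ a *m b^T = b *m a^T, a *m d^T = 1%:M + b *m c^T & c *m d^T = d *m c^T].
Proof. by move=> /symplectic_tr; rewrite tr_block_mx => /symplectic_blockP; rewrite !trmxK. Qed.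

(* The second row block of [M] has rank [n], because d a^t - c b^t = 1. *)
Lemma spd_bottom_gram a b c d : symplectic (block_mx a b c d) ->
  spd (d *m d^T + c *m c^T).
Proof.
move=> /symplectic_tr_blockP[_ ad _]; split=> [|w w0].
  by rewrite trmxD !trmx_mul !trmxK.
rewrite mulmxDr mulmxDl addmxE !mulmxA -!(mulmxA (w *m _)) -!trmx_mul.
have [wd|/rv_sqnorm_gt0 wd] := eqVneq (w *m d) 0; last first.
  by rewrite ltr_wpDr// rv_sqnormE sumr_ge0// => i _; rewrite sqr_ge0.
rewrite wd mul0mx mxE add0r rv_sqnorm_gt0//.
apply: contra w0 => /eqP wc.
have /(congr1 (mulmx w)) : d *m a^T = 1%:M + c *m b^T.
  by have /(congr1 trmx) := ad; rewrite trmxD !trmx_mul !trmxK trmx1.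
by rewrite mulmxDr !mulmxA wd wc !mul0mx mulmx1 addr0 => ->.
Qed.

Definition iw_pt M : 'M[R[i]]_n := cplx (iw_x M) (iw_y M).

Lemma iw_yE a b c d : iw_y (block_mx a b c d) = invmx (d *m d^T + c *m c^T).
Proof. by rewrite /iw_y block_mxKdl block_mxKdr. Qed.

Lemma iw_xE a b c d : iw_x (block_mx a b c d) =
  invmx (d *m d^T + c *m c^T) *m (d *m b^T + c *m a^T).
Proof. by rewrite /iw_x iw_yE block_mxKul block_mxKur block_mxKdl block_mxKdr. Qed.

(** [cplx d c] is the automorphy factor c i + d at the base point. Its product with d^t - i c^t is
    the positive definite d d^t + c c^t, the imaginary part vanishing by c d^t = d c^t. *)
Lemma automorphy_base_unitmx a b c d : symplectic (block_mx a b c d) ->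
  cplx d c \in unitmx.
Proof.
move=> sM; have [_ _ cd] := symplectic_tr_blockP sM.
have : cplx d c *m cplx d^T (- c^T) \in unitmx.
  rewrite cplxM !mulmxN opprK cd addNr -toCE map_unitmx.
  exact: spd_unitmx (spd_bottom_gram sM).
by rewrite unitmx_mul => /andP[].
Qed.

Lemma iw_ptM a b c d : symplectic (block_mx a b c d) ->
  iw_pt (block_mx a b c d) *m cplx d c = cplx b a.
Proof.
move=> sM; have [ac ad bd] := (symplectic_blockP _ _ _ _).1 sM.
have [_ _ cd] := symplectic_tr_blockP sM.
have uy := spd_unitmx (spd_bottom_gram sM).
have da : d^T *m a = 1%:M + b^T *m c.
  by have /(congr1 trmx) := ad; rewrite trmxD !trmx_mul !trmxK trmx1.
rewrite /iw_pt iw_yE iw_xE cplxM.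
have := mulKVmx uy (d *m b^T + c *m a^T); have := mulmxV uy.
move: (invmx _) => y; move: (y *m _) => x ye xe.
(* Real and imaginary parts are compared after multiplication by d d^t + c c^t, which removes the
   inverse hidden in x and y and leaves the block relations. *)
congr cplx; apply: (can_inj (mulKmx uy)).
  rewrite mulmxBr !(mulmxA (_ + _)) xe ye mul1mx !mulmxDl -!mulmxA bd ad mulmxDr mulmx1.
  mxabel.
rewrite mulmxDr !(mulmxA (_ + _)) xe ye mul1mx !mulmxDl -!mulmxA da ac mulmxDr mulmx1.
mxabel.
Qed.

Lemma spd_iw_y M : symplectic M -> spd (iw_y M).
Proof.
rewrite -[M]submxK iw_yE => sM; exact: spd_inv (spd_bottom_gram sM).
Qed.

(** Multiplying [iw_ptM] by d^t - i c^t gives the mirrored formula x = (b d^t + a c^t) y, which is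
    the transpose of the defining one. *)
Lemma iw_x_sym M : symplectic M -> (iw_x M)^T = iw_x M.
Proof.
move=> sM; have := sM; rewrite -[M]submxK.
set a := ulsubmx M; set b := ursubmx M; set c := dlsubmx M; set d := drsubmx M.
move=> {}sM; have [_ _ cd] := symplectic_tr_blockP sM.
have [ysym _] := spd_bottom_gram sM; have uy := spd_unitmx (spd_bottom_gram sM).
have /(congr1 (mulmx^~ (cplx d^T (- c^T)))) := iw_ptM sM.
rewrite -mulmxA !cplxM !mulmxN !opprK cd addNr => /cplx_inj[].
rewrite ?mulmx0 ?subr0 => /(congr1 (mulmx^~ (invmx (d *m d^T + c *m c^T)))).
rewrite mulmxK// => xE _; rewrite {1}xE iw_xE trmx_mul trmx_inv ysym.
by rewrite trmxD !trmx_mul !trmxK.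
Qed.

Lemma siegel_iw_pt M : symplectic M -> siegel (iw_pt M).
Proof.
move=> sM; exists (iw_x M), (iw_y M); split=> //; [exact: iw_x_sym | exact: spd_iw_y].
Qed.

Lemma iw_pt_surj x y : x^T = x -> spd y ->
  exists M, [/\ symplectic M, iw_x M = x & iw_y M = y].
Proof.
move=> xsym sy; have [ss s2] := mxsqrtP sy; set s := mxsqrt y in ss s2.
have us := spd_unitmx ss; have [ssym _] := ss.
exists (block_mx s (x *m invmx s) 0 (invmx s)).
have yE : invmx (invmx s *m (invmx s)^T + (0 : 'M[R]_n) *m 0^T) = y.
  rewrite mul0mx addr0 trmx_inv ssym -s2; apply: invmx_eq.
  by rewrite -mulmxA mulKmx// mulVmx.
split; rewrite ?iw_xE ?iw_yE ?yE//; last first.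
  rewrite mul0mx addr0 trmx_mul trmx_inv ssym xsym -s2 !mulmxA.
  by rewrite mulmxK// mulmxV// mul1mx.
apply/symplectic_blockP; rewrite !trmx0 !mul0mx mulmx0 addr0 trmx_mul !trmx_inv ssym xsym.
by split=> //; rewrite ?mulmxV// !mulmxA.
Qed.

Lemma siegel_iw_ptP v : siegel v -> exists2 M, symplectic M & v = iw_pt M.
Proof.
by move=> [x [y [-> xsym /(iw_pt_surj xsym)[M [sM xE yE]]]]]; exists M; rewrite // /iw_pt xE yE.
Qed.

(** The block row (A, B) acts on the two rows of [iw_ptM]. For (A, B) = (c, d) this is the cocycle
    property of the automorphy factor; for (a, b) it is its counterpart for the numerator. *)
Lemma toC_iw_ptM a b c d (A B : 'M[R]_n) : symplectic (block_mx a b c d) ->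
  (toC A *m iw_pt (block_mx a b c d) + toC B) *m cplx d c =
  cplx (A *m b + B *m d) (A *m a + B *m c).
Proof.
move=> sM; rewrite mulmxDl -mulmxA iw_ptM// !toCE !cplxM cplxD.
by rewrite !mul0mx !addr0 !subr0.
Qed.

(** Writing v as the point of N exhibits c v + d as a left factor of the automorphy factor of M N at
    the base point, which is invertible. *)
Lemma automorphy_unitmx a b c d v : symplectic (block_mx a b c d) -> siegel v ->
  toC c *m v + toC d \in unitmx.
Proof.
move=> sM /siegel_iw_ptP[N sN ->]; have sMN := symplectic_mul sM sN.
rewrite -[N]submxK mulmx_block in sN sMN *.
have := toC_iw_ptM c d sN => /(congr1 (fun A => A \in unitmx)).
by rewrite unitmx_mul (automorphy_base_unitmx sMN) => /andP[].
Qed.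

Definition siegel_act a b c d (v : 'M[R[i]]_n) : 'M[R[i]]_n :=
  (toC a *m v + toC b) *m invmx (toC c *m v + toC d).

Lemma iw_pt_mul a b c d N : symplectic (block_mx a b c d) -> symplectic N ->
  iw_pt (block_mx a b c d *m N) = siegel_act a b c d (iw_pt N).
Proof.
move=> sM sN; have sMN := symplectic_mul sM sN.
have uZ := automorphy_unitmx sM (siegel_iw_pt sN).
rewrite -[N]submxK mulmx_block in sN sMN uZ *.
have uN := automorphy_base_unitmx sN.
have := iw_ptM sMN; rewrite -!toC_iw_ptM// mulmxA => /(can_inj (mulmxK uN)).
by rewrite /siegel_act => <-; rewrite mulmxK.
Qed.

Lemma siegel_siegel_act a b c d v : symplectic (block_mx a b c d) -> siegel v ->
  siegel (siegel_act a b c d v).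
Proof.
move=> sM /siegel_iw_ptP[N sN ->]; rewrite -iw_pt_mul//.
exact/siegel_iw_pt/symplectic_mul.
Qed.

Lemma toCM m p r (A : 'M[R]_(m, p)) (B : 'M[R]_(p, r)) : toC (A *m B) = toC A *m toC B.
Proof. exact: map_mxM. Qed.

Lemma toCD m p (A B : 'M[R]_(m, p)) : toC (A + B) = toC A + toC B.
Proof. exact: map_mxD. Qed.

Lemma toCT m p (A : 'M[R]_(m, p)) : toC A^T = (toC A)^T.
Proof. by apply/matrixP => i j; rewrite !mxE. Qed.

Lemma toC1 m : toC (1%:M : 'M[R]_m) = 1%:M.
Proof. exact: map_mx1. Qed.

Lemma siegel_sym (v : 'M[R[i]]_n) : siegel v -> v^T = v.
Proof. by move=> [x [y [-> xsym [ysym _]]]]; rewrite cplxT xsym ysym. Qed.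

Lemma toC_symplectic a b c d : symplectic (block_mx a b c d) ->
  let A := toC a in let B := toC b in let C := toC c in let D := toC d in
  [/\ A^T *m C = C^T *m A, A^T *m D = 1%:M + C^T *m B & B^T *m D = D^T *m B].
Proof.
move=> /symplectic_blockP[e1 e2 e3]; rewrite /= -!toCT -!toCM.
by rewrite -toC1 -toCD e1 e2 e3.
Qed.

Lemma automorphy_tr_unitmx a b c d v : symplectic (block_mx a b c d) -> siegel v ->
  v *m (toC c)^T + (toC d)^T \in unitmx.
Proof.
move=> sM sv; rewrite -unitmx_tr trmxD trmx_mul !trmxK (siegel_sym sv).
exact: automorphy_unitmx sM sv.
Qed.

(** Both v and its image are symmetric, so transposing the definition gives the second
    expression. *)
Lemma siegel_act_tr a b c d v : symplectic (block_mx a b c d) -> siegel v ->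
  siegel_act a b c d v =
  invmx (v *m (toC c)^T + (toC d)^T) *m (v *m (toC a)^T + (toC b)^T).
Proof.
move=> sM sv; rewrite -(siegel_sym (siegel_siegel_act sM sv)) /siegel_act.
have tD (A B : 'M[R]_n) : (toC A *m v + toC B)^T = v *m (toC A)^T + (toC B)^T.
  by rewrite trmxD trmx_mul (siegel_sym sv).
by rewrite trmx_mul trmx_inv !tD.
Qed.

Lemma automorphy_conj_unitmx a b c d v : symplectic (block_mx a b c d) -> siegel v ->
  cconjmx v *m (toC c)^T + (toC d)^T \in unitmx.
Proof.
move=> sM sv; have uZ := automorphy_tr_unitmx sM sv.
have -> : cconjmx v *m (toC c)^T + (toC d)^T =
    map_mx Num.conj (v *m (toC c)^T + (toC d)^T).
  have tc (A : 'M[R]_n) : map_mx Num.conj (toC A) = toC A.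
    by have := cplx_conj A 0; rewrite oppr0 -toCE.
  by rewrite map_mxD map_mxM -!toCT !tc.
by rewrite map_unitmx.
Qed.

End Symplectic.

(** * Matrix identities behind the equivalent expressions for v_1 *)

Section AbstractSiegel.
Context {F : numFieldType} {n : nat}.
Implicit Types (A B C D v w x y z t : 'M[F]_n).

(** Used with w the conjugate of v and t = i y. Expanding the left side leaves a lone summand v,
    which is split as (w + v)/2 + t; the halves account for the 1 in A^t D = 1 + C^t B and in its
    transpose. *)
Lemma mobius_conj_num A B C D v w t :
  A^T *m C = C^T *m A -> A^T *m D = 1%:M + C^T *m B -> B^T *m D = D^T *m B ->
  v = w + 2%:R *: t ->
  (w *m C^T + D^T) *m (A *m v + B) =
  2%:R^-1 *: (2%:R *: (w *m A^T *m C *m v) + w *m (C^T *m B + A^T *m D)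
              + (B^T *m C + D^T *m A) *m v + 2%:R *: (B^T *m D)) + t.
Proof.
move=> AC AD BD vw.
have DA : D^T *m A = 1%:M + B^T *m C.
  by have /(congr1 trmx) := AD; rewrite trmxD !trmx_mul !trmxK trmx1.
have -> : (w *m C^T + D^T) *m (A *m v + B) =
    w *m A^T *m C *m v + w *m (C^T *m B) + v + B^T *m C *m v + B^T *m D.
  rewrite mulmxDl !mulmxDr -mulmxA (mulmxA C^T) -AC (mulmxA D^T) DA BD mulmxDl mul1mx.
  rewrite !mulmxA; mxabel.
rewrite AD DA !mulmxDl !mulmxDr mulmx1 mul1mx; move: (w *m A^T *m C *m v) => S.
move: (B^T *m C *m v) (w *m _) (B^T *m D) => S1 S2 S3.
rewrite vw; apply/matrixP => j k; rewrite !(addmxE, scalemxE).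
by field.
Qed.

(** Origin of the real denominator: v C^t + D^t is multiplied on the left by (C w + D) y^-1, where w
    = x - i y. Here w y^-1 v = y + x y^-1 x is real, and the imaginary cross terms cancel by C D^t =
    D C^t. *)
Lemma mobius_real_den (i : F) C D x y z :
  i * i = -1 -> y *m z = 1%:M -> C *m D^T = D *m C^T ->
  (C *m (x - i *: y) + D) *m z *m ((x + i *: y) *m C^T + D^T) =
  C *m (y + x *m z *m x) *m C^T + D *m z *m D^T + C *m x *m z *m D^T + D *m z *m x *m C^T.
Proof.
move=> ii yz CD; have zy := mulmx1C yz.
rewrite !(mulmxDl, mulmxDr, mulmxBr, mulNmx, mulmxN).
rewrite ?(=^~ scalemxAl, =^~ scalemxAr) -!mulmxA !(mulmxA y) !(mulmxA z y) yz zy !mul1mx.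
rewrite ?(=^~ scalemxAl, =^~ scalemxAr) scalerA ii CD.
apply/matrixP => j k; rewrite !(addmxE, oppmxE, scalemxE); ring.
Qed.

(** The same multiplier applied to the numerator; the cross terms now leave i (D A^t - C B^t) =
    i. *)
Lemma mobius_real_num (i : F) A B C D x y z :
  i * i = -1 -> y *m z = 1%:M -> A *m D^T = 1%:M + B *m C^T ->
  (C *m (x - i *: y) + D) *m z *m ((x + i *: y) *m A^T + B^T) =
  C *m (y + x *m z *m x) *m A^T + C *m x *m z *m B^T + D *m z *m x *m A^T
    + D *m z *m B^T + i%:M.
Proof.
move=> ii yz AD; have zy := mulmx1C yz.
have DA : D *m A^T = 1%:M + C *m B^T.
  by have /(congr1 trmx) := AD; rewrite trmxD !trmx_mul !trmxK trmx1.
rewrite !(mulmxDl, mulmxDr, mulmxBr, mulNmx, mulmxN).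
rewrite ?(=^~ scalemxAl, =^~ scalemxAr) -!mulmxA !(mulmxA y) !(mulmxA z y) yz zy !mul1mx.
rewrite ?(=^~ scalemxAl, =^~ scalemxAr) scalerA ii DA -[i%:M]scalemx1.
apply/matrixP => j k; rewrite !(addmxE, oppmxE, scalemxE); ring.
Qed.

Lemma map_real_den (K : fieldType) (f : {rmorphism K -> F}) (c d x y z : 'M[K]_n) :
  map_mx f (c *m (y + x *m z *m x) *m c^T + d *m z *m d^T + c *m x *m z *m d^T
            + d *m z *m x *m c^T) =
  let C := map_mx f c in let D := map_mx f d in
  let X := map_mx f x in let Y := map_mx f y in let Z := map_mx f z in
  C *m (Y + X *m Z *m X) *m C^T + D *m Z *m D^T + C *m X *m Z *m D^T + D *m Z *m X *m C^T.
Proof. by rewrite !(map_mxD, map_mxM) -!map_trmx. Qed.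

Lemma map_real_num (K : fieldType) (f : {rmorphism K -> F}) (a b c d x y z : 'M[K]_n) :
  map_mx f (c *m (y + x *m z *m x) *m a^T + c *m x *m z *m b^T + d *m z *m x *m a^T
            + d *m z *m b^T) =
  let A := map_mx f a in let B := map_mx f b in
  let C := map_mx f c in let D := map_mx f d in
  let X := map_mx f x in let Y := map_mx f y in let Z := map_mx f z in
  C *m (Y + X *m Z *m X) *m A^T + C *m X *m Z *m B^T + D *m Z *m X *m A^T + D *m Z *m B^T.
Proof. by rewrite !(map_mxD, map_mxM) -!map_trmx. Qed.

Lemma invmx_cancel A B C D : A \in unitmx -> B \in unitmx -> C \in unitmx ->
  invmx (A *m B *m C) *m (A *m B *m D) = invmx C *m D.
Proof.
move=> uA uB uC; have uABC : A *m B *m C \in unitmx by rewrite !unitmx_mul uA uB.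
by apply: (can_inj (mulKmx uABC)); rewrite mulKVmx// -[RHS]mulmxA mulKVmx.
Qed.

End AbstractSiegel.

(** * Real and conjugate expressions for v_1 *)

Section SiegelFormulas.
Context {R : realType} {n : nat}.
Implicit Types (a b c d x y : 'M[R]_n) (M N : 'M[R]_(n + n)).

Definition real_num a b c d x y : 'M[R]_n :=
  c *m (y + x *m invmx y *m x) *m a^T + c *m x *m invmx y *m b^T
  + d *m invmx y *m x *m a^T + d *m invmx y *m b^T.

Definition real_den c d x y : 'M[R]_n :=
  c *m (y + x *m invmx y *m x) *m c^T + d *m invmx y *m d^T
  + c *m x *m invmx y *m d^T + d *m invmx y *m x *m c^T.

Lemma siegel_act_conjE a b c d x y : symplectic (block_mx a b c d) -> siegel (cplx x y) ->
  let v := cplx x y in let w := cconjmx v in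
  let A := toC a in let B := toC b in let C := toC c in let D := toC d in
  siegel_act a b c d v = invmx (w *m C^T + D^T) *m
    (2%:R^-1 *: (2%:R *: (w *m A^T *m C *m v) + w *m (C^T *m B + A^T *m D)
       + (B^T *m C + D^T *m A) *m v + 2%:R *: (B^T *m D)) + 'i%C *: toC y)
    *m invmx (C *m v + D).
Proof.
move=> sM sv /=; have [AC AD BD] := toC_symplectic sM.
have uW := automorphy_conj_unitmx sM sv.
have vw : cplx x y = cconjmx (cplx x y) + 2%:R *: ('i%C *: toC y).
  by rewrite cplx_conj scaler_nat mulr2n scale_i_toC !cplxD !add0r !addr0 addKr.
by rewrite -(mobius_conj_num AC AD BD vw) mulKmx.
Qed.

Lemma siegelP x y : siegel (cplx x y) <-> x^T = x /\ spd y.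
Proof.
split=> [[x' [y' [/cplx_inj[-> ->]]]]//|[xsym sy]]; by exists x, y.
Qed.

Lemma toC_unitmx m (A : 'M[R]_m) : (toC A \in unitmx) = (A \in unitmx).
Proof. exact: map_unitmx. Qed.

Lemma cplxE m r (A B : 'M[R]_(m, r)) : cplx A B = toC A + 'i%C *: toC B.
Proof. by rewrite scale_i_toC toCE cplxD addr0 add0r. Qed.

Lemma siegel_act_real a b c d x y : symplectic (block_mx a b c d) -> siegel (cplx x y) ->
  real_den c d x y \in unitmx /\
  siegel_act a b c d (cplx x y) =
  invmx (toC (real_den c d x y)) *m (toC (real_num a b c d x y) + 'i%C%:M).
Proof.
move=> sM sv; have [xsym sy] := (siegelP _ _).1 sv.
have uy := spd_unitmx sy; have ysym := sy.1.
have ii : 'i%C * 'i%C = -1 :> R[i] by rewrite -expr2 sqr_i.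
have yz : toC y *m toC (invmx y) = 1%:M by rewrite -toCM mulmxV// toC1.
have [_ /(congr1 (@toC R n n)) + /(congr1 (@toC R n n))] := symplectic_tr_blockP sM.
rewrite toCD !toCM !toCT toC1 => AD CD.
have uT := automorphy_tr_unitmx sM sv.
have uK : toC c *m (toC x - 'i%C *: toC y) + toC d \in unitmx.
  have := automorphy_conj_unitmx sM sv; rewrite -unitmx_tr trmxD trmx_mul !trmxK cplx_conj.
  by rewrite cplxT trmxN xsym ysym cplxE /toC map_mxN scalerN.
have denE : toC (real_den c d x y) =
    (toC c *m (toC x - 'i%C *: toC y) + toC d) *m toC (invmx y)
    *m (cplx x y *m (toC c)^T + (toC d)^T).
  by rewrite cplxE (mobius_real_den _ ii yz CD); exact: map_real_den.
have numE : toC (real_num a b c d x y) + 'i%C%:M =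
    (toC c *m (toC x - 'i%C *: toC y) + toC d) *m toC (invmx y)
    *m (cplx x y *m (toC a)^T + (toC b)^T).
  rewrite cplxE (mobius_real_num _ ii yz AD); congr (_ + _); exact: map_real_num.
have uz : toC (invmx y) \in unitmx by rewrite toC_unitmx unitmx_inv.
split; first by rewrite -toC_unitmx denE !unitmx_mul uK uz uT.
rewrite (siegel_act_tr sM sv) numE denE; exact/esym/(invmx_cancel _ uK uz uT).
Qed.

Lemma siegel_act_parts a b c d x y : symplectic (block_mx a b c d) -> siegel (cplx x y) ->
  siegel_act a b c d (cplx x y) =
  cplx (invmx (real_den c d x y) *m real_num a b c d x y) (invmx (real_den c d x y)).
Proof.
move=> sM sv; have [_ ->] := siegel_act_real sM sv.
rewrite cplxE toCM [toC (invmx _)]map_invmx -/(toC _) mulmxDr; congr (_ + _).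
by rewrite scalar_mxC mul_scalar_mx.
Qed.

End SiegelFormulas.

Lemma invmxM (F : comUnitRingType) n (A B : 'M[F]_n) : A \in unitmx -> B \in unitmx ->
  invmx (A *m B) = invmx B *m invmx A.
Proof.
by move=> uA uB; apply: invmx_eq; rewrite -mulmxA mulKVmx// mulmxV.
Qed.

(** * The Jacobi group, its cosets and their realizations *)

Section JacobiGroupTheory.
Context {R : realType} {n : nat}.
Implicit Types (g h k : jacobi R n) (w : 'rV[R]_(n + n)) (M : 'M[R]_(n + n)).

Definition sform w w' : R := (w *m symplectic_form n *m w'^T) 0 0.

Definition jrow g : 'rV[R]_(n + n) := row_mx (jlambda g) (jmu g).

Definition jpq g : 'rV[R]_(n + n) := jrow g *m invmx (jM g).

Lemma sformE (l m l' m' : 'rV[R]_n) :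
  sform (row_mx l m) (row_mx l' m') = (l *m m'^T) 0 0 - (m *m l'^T) 0 0.
Proof.
rewrite /sform /symplectic_form mul_row_block !(mulmx0, mulmx1, add0r, addr0, mulmxN).
by rewrite tr_row_mx mul_row_col addmxE mulNmx oppmxE addrC.
Qed.

Lemma sformDl w1 w2 w : sform (w1 + w2) w = sform w1 w + sform w2 w.
Proof. by rewrite /sform !mulmxDl addmxE. Qed.

Lemma sformDr w w1 w2 : sform w (w1 + w2) = sform w w1 + sform w w2.
Proof. by rewrite /sform trmxD !mulmxDr addmxE. Qed.

Lemma sform_symplectic M w w' : symplectic M -> sform (w *m M) (w' *m M) = sform w w'.
Proof.
move=> /symplectic_tr; rewrite /symplectic /= trmxK => sM.
by rewrite /sform trmx_mul !mulmxA -(mulmxA w) -(mulmxA w) sM.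
Qed.

Lemma jM_mulJ g h : jM (mulJ g h) = jM g *m jM h.
Proof. by []. Qed.

Lemma jrow_mulJ g h : jrow (mulJ g h) = jrow g *m jM h + jrow h.
Proof. by rewrite /jrow /= -add_row_mx hsubmxK. Qed.

Lemma jkappa_mulJ g h :
  jkappa (mulJ g h) = jkappa g + jkappa h + sform (jrow g *m jM h) (jrow h).
Proof. by rewrite -[jrow g *m jM h]hsubmxK sformE addrA. Qed.

Lemma jacobi_eq g h : jM g = jM h -> jrow g = jrow h -> jkappa g = jkappa h -> g = h.
Proof. by case: g h => [M l m k0] [M' l' m' k1] /= -> /eq_row_mx[/= -> ->] ->. Qed.

(** In the kappa component this is the cocycle identity: one side pairs two rows before, the other
    after right multiplication by [jM k], so the symplectic condition is asked of k. *)
Lemma mulJA g h k : GJ k -> mulJ g (mulJ h k) = mulJ (mulJ g h) k.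
Proof.
move=> sk; apply: jacobi_eq; first by rewrite !jM_mulJ mulmxA.
  by rewrite !jrow_mulJ jM_mulJ mulmxDl !mulmxA addrA.
rewrite !(jkappa_mulJ, jrow_mulJ) !jM_mulJ !mulmxDl !(sformDl, sformDr) !mulmxA.
by rewrite (sform_symplectic _ _ sk); ring.
Qed.

Lemma GJ_mulJ g h : GJ g -> GJ h -> GJ (mulJ g h).
Proof. exact: symplectic_mul. Qed.

Lemma jpq_mulJ g h : GJ g -> GJ h -> jpq (mulJ g h) = jpq g + jpq h *m invmx (jM g).
Proof.
move=> sg sh; have ug := symplectic_unitmx sg; have uh := symplectic_unitmx sh.
by rewrite /jpq jrow_mulJ jM_mulJ invmxM// mulmxDl !mulmxA mulmxK.
Qed.

Lemma jkappa_mulJ_pq g h : GJ h ->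
  jkappa (mulJ g h) = jkappa g + jkappa h + sform (jrow g) (jpq h).
Proof.
move=> sh; rewrite jkappa_mulJ -(sform_symplectic (jrow g) (jpq h) sh) /jpq.
by rewrite mulmxKV// symplectic_unitmx.
Qed.

Lemma jpqE g : jpq g = row_mx (jp g) (jq g).
Proof. by rewrite hsubmxK. Qed.

Lemma unitary_spP M : unitary_sp M -> exists X Y : 'M[R]_n,
  [/\ M = block_mx X Y (- Y) X, X *m X^T + Y *m Y^T = 1%:M & X *m Y^T = Y *m X^T].
Proof.
move=> [X [Y [/unitarymxP XY ->]]]; exists X, Y.
have {XY}: cplx X Y *m cconjmx (cplx X Y)^T = 1%:M by exact: XY.
rewrite cplxT cplx_conj cplxM !mulmxN opprK -toC1 toCE => /cplx_inj[XX XY]; split=> //.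
by apply/esym/eqP; rewrite -subr_eq0 addrC XY.
Qed.

Lemma unitary_sp_symplectic M : unitary_sp M -> symplectic M.
Proof.
(* The relations extracted from unitarity concern U U^* = 1, that is products X X^t and X Y^t, so
   the block criterion is applied to the transpose. *)
move=> /unitary_spP[X [Y [-> XX XY]]]; rewrite -[block_mx _ _ _ _]trmxK.
apply: symplectic_tr; rewrite tr_block_mx; apply/symplectic_blockP.
by rewrite !trmxN !trmxK !mulNmx !mulmxN -XX addrK XY.
Qed.

Lemma unitary_sp1 : unitary_sp (1%:M : 'M[R]_(n + n)).
Proof.
exists 1%:M, 0; split; last by rewrite oppr0 -scalar_mx_block.
by rewrite -toCE toC1; apply/unitarymxP; rewrite trmx1 map_mx1 mulmx1.
Qed.

(** Right multiplication by K multiplies both d + i c and b + i a on the right by X - i Y, so their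
    quotient, the point, is unchanged. *)
Lemma iw_pt_unitary M (K : 'M[R]_(n + n)) : symplectic M -> unitary_sp K ->
  iw_pt (M *m K) = iw_pt M.
Proof.
move=> sM uK; have sMK := symplectic_mul sM (unitary_sp_symplectic uK).
have [X [Y [KE _ _]]] := unitary_spP uK.
move: sM sMK; rewrite KE -[M]submxK.
set a := ulsubmx M; set b := ursubmx M; set c := dlsubmx M; set d := drsubmx M.
move=> sM; rewrite mulmx_block !mulmxN => sMK.
have uZ := automorphy_base_unitmx sMK; apply: (can_inj (mulmxK uZ)).
rewrite (iw_ptM sMK).
have -> : cplx (c *m Y + d *m X) (c *m X - d *m Y) = cplx d c *m cplx X (- Y).
  by rewrite cplxM !mulmxN opprK addrC [c *m X - _]addrC.
rewrite mulmxA (iw_ptM sM) cplxM !mulmxN opprK.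
by congr cplx; rewrite addrC.
Qed.

Lemma jpq_mul_UnR g k : GJ g -> UnR k -> jpq (mulJ g k) = jpq g.
Proof.
move=> sg [uk lk mk]; rewrite jpq_mulJ//; last exact: unitary_sp_symplectic.
by rewrite /jpq /jrow lk mk row_mx0 !mul0mx addr0.
Qed.

Lemma UnR_GJ k : UnR k -> GJ k.
Proof. by move=> [/unitary_sp_symplectic]. Qed.

Definition jcoords g : @ext_coords R n :=
  (iw_x (jM g), iw_y (jM g), jp g, jq g, jkappa g).

Lemma extSJ_pointE g : extSJ_point g = extSJ_chart (jcoords g).
Proof. by []. Qed.

Lemma SJ_point_mul_UnR g k : GJ g -> UnR k -> SJ_point (mulJ g k) = SJ_point g.
Proof.
move=> sg uk; have := jpq_mul_UnR sg uk; rewrite !jpqE => /eq_row_mx[pE qE].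
have [uM _ _] := uk; have /cplx_inj[xE yE] := iw_pt_unitary sg uM.
by rewrite /SJ_point pE qE jM_mulJ xE yE.
Qed.

Lemma extSJ_point_mul_Un g k : GJ g -> Un k -> extSJ_point (mulJ g k) = extSJ_point g.
Proof.
move=> sg [uk k0]; rewrite /extSJ_point SJ_point_mul_UnR// jkappa_mulJ k0 addr0.
have [_ lk mk] := uk.
by rewrite /jrow lk mk row_mx0 /sform trmx0 mulmx0 mxE addr0.
Qed.

Definition idJ : jacobi R n := Jacobi 1%:M 0 0 0.

Lemma Un_idJ : Un idJ.
Proof. by split=> //; split=> //; exact: unitary_sp1. Qed.

Lemma mulJ1 g : mulJ g idJ = g.
Proof.
apply: jacobi_eq; rewrite ?jM_mulJ ?jrow_mulJ ?jkappa_mulJ /= ?mulmx1//.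
  by rewrite /jrow row_mx0 addr0.
by rewrite /jrow row_mx0 /sform trmx0 mulmx0 mxE !addr0.
Qed.

(** Turns the relation into a function, for both homogeneous spaces at once. The last two
    assumptions on [pt] say that it is constant on cosets and that left multiplication by g descends
    to its values. *)
Lemma coset_actionP (P : Type) (K : set (jacobi R n)) (pt : jacobi R n -> P) g h m1 :
    K idJ -> K `<=` GJ ->
    (forall g' k, GJ g' -> K k -> pt (mulJ g' k) = pt g') ->
    (forall h1 h2, GJ h1 -> GJ h2 -> pt h1 = pt h2 -> pt (mulJ g h1) = pt (mulJ g h2)) ->
    GJ g -> GJ h ->
  coset_action K pt g (pt h) m1 <-> m1 = pt (mulJ g h).
Proof.
move=> K1 KG ptK ptg sg sh; split; last first.
  move=> ->; exists [set mulJ h k | k in K]; split; first by exists h.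
  exists (mulJ g h); split=> //; first exact: GJ_mulJ.
  apply/seteqP; split=> [_ [_ [k Kk <-] <-]|_ [k Kk <-]].
    by exists k; rewrite // mulJA//; exact: KG.
  by exists (mulJ h k); [exists k|rewrite mulJA//; exact: KG].
move=> [C [[h' [sh' -> hE]] [g1 [sg1 CE ->]]]].
(* As K contains the identity, the representative g1 lies in its own coset, hence has the form g (h'
   k). *)
have : [set mulJ g1 k | k in K] g1 by exists idJ; rewrite ?mulJ1.
rewrite -CE => -[_ [k Kk <-] <-]; apply: ptg => //.
  exact/GJ_mulJ/KG.
by rewrite ptK.
Qed.

End JacobiGroupTheory.

Lemma mulmx_row_mobius (F : pzRingType) n (A B C D v : 'M[F]_n) (p q p' q' l r : 'rV[F]_n) :
  p *m A + q *m C = l + p' -> p *m B + q *m D = r + q' ->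
  p *m (A *m v + B) + q *m (C *m v + D) = p' *m v + q' + l *m v + r.
Proof.
move=> e1 e2; rewrite !mulmxDr !mulmxA addrACA -mulmxDl e1 e2 mulmxDl addrACA [LHS]addrC.
by rewrite addrA.
Qed.

(** * Charts and the action in coordinates *)

Section Coordinates.
Context {R : realType} {n : nat}.
Implicit Types (g h : jacobi R n) (a b c d x y : 'M[R]_n) (p q : 'rV[R]_n).
Implicit Type m : @ext_coords R n.

Lemma SJ_chartE x y p q : SJ_chart x y p q = (cplx x y, cplx (p *m x + q) (p *m y)).
Proof.
rewrite /SJ_chart; congr pair.
by rewrite !toCE cplxM cplxD !mul0mx subr0 !addr0.
Qed.

Lemma SJ_chart_inj x y p q x' y' p' q' : y \in unitmx ->
  SJ_chart x y p q = SJ_chart x' y' p' q' -> [/\ x = x', y = y', p = p' & q = q'].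
Proof.
move=> uy; rewrite !SJ_chartE => -[/cplx_inj[<- <-] /cplx_inj[+ /(can_inj (mulmxK uy)) pp]].
by rewrite -pp => /addrI.
Qed.

Lemma SJ_chart_surj x y (u : 'rV[R[i]]_n) : y \in unitmx ->
  exists p q, SJ_chart x y p q = (cplx x y, u).
Proof.
move=> uy; have [r [s ->]] := cplx_surj u.
exists (s *m invmx y), (r - s *m invmx y *m x).
by rewrite SJ_chartE mulmxKV// addrC subrK.
Qed.

Lemma extSJ_chart_inj m m' : ext_domain m -> extSJ_chart m = extSJ_chart m' -> m = m'.
Proof.
move: m m' => [[[[x y] p] q] k] [[[[x' y'] p'] q'] k'] [_ /spd_unitmx uy].
by move=> [e1 e2 ->]; have [-> -> -> ->] := SJ_chart_inj uy (congr2 pair e1 e2).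
Qed.

Lemma jcoords_domain h : GJ h -> ext_domain (jcoords h).
Proof. by move=> sh; split; [exact: iw_x_sym|exact: spd_iw_y]. Qed.

Lemma jcoords_surj m : ext_domain m -> exists2 h, GJ h & jcoords h = m.
Proof.
move: m => [[[[x y] p] q] k] [/iw_pt_surj /[apply] -[M [sM <- <-]]].
have uM := symplectic_unitmx sM.
exists (Jacobi M (lsubmx (row_mx p q *m M)) (rsubmx (row_mx p q *m M)) k) => //.
by rewrite /jcoords /jp /jq /= hsubmxK mulmxK// row_mxKl row_mxKr.
Qed.

(** Explicit candidate for the action, given by a formula at all coordinates: rational in (x, y),
    affine in (p, q, kappa). It agrees with [extSJ_map] on [ext_domain] when g lies in the group. *)
Definition ext_map g m : @ext_coords R n :=
  let: (x, y, p, q, k) := m in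
  let a := ulsubmx (jM g) in let b := ursubmx (jM g) in
  let c := dlsubmx (jM g) in let d := drsubmx (jM g) in
  let w := jpq g + row_mx p q *m invmx (jM g) in
  (invmx (real_den c d x y) *m real_num a b c d x y, invmx (real_den c d x y),
   lsubmx w, rsubmx w, jkappa g + k + sform (jrow g) (row_mx p q)).

Lemma jcoords_mulJ g h : GJ g -> GJ h -> jcoords (mulJ g h) = ext_map g (jcoords h).
Proof.
move=> sg sh; have sM := sg; rewrite /GJ/= -[jM g]submxK in sM.
have := iw_pt_mul sM sh; rewrite (siegel_act_parts sM (siegel_iw_pt sh)) submxK.
move=> /cplx_inj[xE yE].
have := jpq_mulJ sg sh; rewrite !(jpqE (mulJ _ _), jpqE h) => wE.
by rewrite /jcoords /ext_map jkappa_mulJ_pq// jpqE -wE row_mxKl row_mxKr jM_mulJ xE yE.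
Qed.

(** Well-definedness on cosets: by [jcoords_mulJ] the coordinates of g h are a function of those of
    h, and the chart is injective on the domain. *)
Lemma extSJ_point_mulJ_eq g h1 h2 : GJ g -> GJ h1 -> GJ h2 ->
  extSJ_point h1 = extSJ_point h2 -> extSJ_point (mulJ g h1) = extSJ_point (mulJ g h2).
Proof.
move=> sg s1 s2; rewrite !extSJ_pointE !jcoords_mulJ// => /extSJ_chart_inj->//.
exact: jcoords_domain.
Qed.

Lemma extSJ_action_jcoords g h z : GJ g -> GJ h ->
  extSJ_action g (extSJ_chart (jcoords h)) z <-> z = extSJ_chart (jcoords (mulJ g h)).
Proof.
move=> sg sh; rewrite -!extSJ_pointE; apply: coset_actionP => //.
- exact: Un_idJ.
- by move=> k [/UnR_GJ].
- exact: extSJ_point_mul_Un.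
- by move=> h1 h2; exact: extSJ_point_mulJ_eq.
Qed.

Lemma extSJ_actionP g m z : GJ g -> ext_domain m ->
  extSJ_action g (extSJ_chart m) z <-> z = extSJ_chart (ext_map g m).
Proof.
move=> sg /jcoords_surj[h sh <-]; rewrite -jcoords_mulJ//.
exact: extSJ_action_jcoords.
Qed.

Lemma ext_map_domain g m : GJ g -> ext_domain m -> ext_domain (ext_map g m).
Proof.
move=> sg /jcoords_surj[h sh <-]; rewrite -jcoords_mulJ//.
exact/jcoords_domain/GJ_mulJ.
Qed.

Lemma extSJ_mapE g m : GJ g -> ext_domain m -> extSJ_map g m = ext_map g m.
Proof.
move=> sg dm; rewrite /extSJ_map; case: xgetP => [z _|/(_ (ext_map g m))] /=.
  rewrite extSJ_actionP// => /esym/extSJ_chart_inj->//; exact: ext_map_domain.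
by rewrite extSJ_actionP.
Qed.

(** kappa does not influence the other components of a product, so h1 may be given the kappa of h2;
    this reduces the claim to the extended space. *)
Lemma SJ_point_mulJ_eq g h1 h2 : GJ g -> GJ h1 -> GJ h2 ->
  SJ_point h1 = SJ_point h2 -> SJ_point (mulJ g h1) = SJ_point (mulJ g h2).
Proof.
move=> sg s1 s2 e; pose h := Jacobi (jM h1) (jlambda h1) (jmu h1) (jkappa h2).
have : extSJ_point h = extSJ_point h2 by rewrite /extSJ_point -e.
by move=> /(@extSJ_point_mulJ_eq g h h2 sg s1 s2)/(congr1 fst).
Qed.

Lemma SJ_action0P (M : 'M[R]_(n + n)) l r h z : symplectic M -> GJ h ->
  SJ_action0 M l r (SJ_point h) z <-> z = SJ_point (mulJ (Jacobi M l r 0) h).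
Proof.
move=> sM sh; have P k : coset_action UnR SJ_point (Jacobi M l r k) (SJ_point h) z <->
    z = SJ_point (mulJ (Jacobi M l r k) h).
  apply: coset_actionP => //.
  - by case: (@Un_idJ R n).
  - by move=> h' /UnR_GJ.
  - by move=> g' h' sg' uh'; exact: SJ_point_mul_UnR.
  - by move=> h1 h2; exact: SJ_point_mulJ_eq.
by split=> [[k /P]//|/P ?]; exists 0.
Qed.

Lemma SJ_point_mulJ a b c d l r k h : let g := Jacobi (block_mx a b c d) l r k in
  GJ g -> GJ h -> let v := iw_pt (jM h) in
  SJ_point (mulJ g h) = (siegel_act a b c d v,
    ((SJ_point h).2 + toC l *m v + toC r) *m invmx (toC c *m v + toC d)).
Proof.
move=> g sg sh v; rewrite /SJ_point /SJ_chart -!/(iw_pt _) jM_mulJ iw_pt_mul// -/v /=.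
congr pair; have uZ := automorphy_unitmx sg (siegel_iw_pt sh); rewrite -/v in uZ.
(* After multiplication by c v + d the second component is p1 (a v + b) + q1 (c v + d), which is
   expanded by (p1, q1) M = (lambda, mu) + (p', q'). *)
apply: (can_inj (mulmxK uZ)); rewrite mulmxKV// mulmxDl /siegel_act mulmxA mulmxKV//.
have /(congr1 (mulmx^~ (jM g))) := jpq_mulJ sg sh.
rewrite jpqE mulmxDl mulmxKV ?symplectic_unitmx// /jpq.
rewrite mulmxKV ?symplectic_unitmx// -/(jpq h) jpqE /= /jrow /= add_row_mx.
rewrite mul_row_block => /eq_row_mx[e1 e2].
have {e1} := congr1 (@toC R 1 n) e1; have {e2} := congr1 (@toC R 1 n) e2.
rewrite !toCD !toCM => e2 e1.
exact: mulmx_row_mobius.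
Qed.

End Coordinates.

(** * Directional derivatives of matrix expressions *)

Section MatrixDerivatives.
Context {R : realType} {V : normedModType R}.
Implicit Types (v x : V).

Lemma derivable_big_sum (I : Type) (r : seq I) (F : I -> V -> R) v x :
  (forall i, derivable (F i) x v) -> derivable (fun y => \sum_(i <- r) F i y) x v.
Proof.
move=> dF; elim: r => [|i r IH].
  by under eq_fun do rewrite big_nil; exact: derivable_cst.
by under eq_fun do rewrite big_cons; exact: derivableD (dF i) IH.
Qed.

Lemma derivable_big_prod (I : Type) (r : seq I) (F : I -> V -> R) v x :
  (forall i, derivable (F i) x v) -> derivable (fun y => \prod_(i <- r) F i y) x v.
Proof.
move=> dF; elim: r => [|i r IH].
  by under eq_fun do rewrite big_nil; exact: derivable_cst.
by under eq_fun do rewrite big_cons; exact: derivableM (dF i) IH.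
Qed.

Lemma derivable_mulmx m n p (A : V -> 'M[R]_(m, n)) (B : V -> 'M[R]_(n, p)) v x :
  derivable A x v -> derivable B x v -> derivable (fun y => A y *m B y) x v.
Proof.
move=> /derivable_mxP dA /derivable_mxP dB; apply/derivable_mxP => i j.
under eq_fun do rewrite mxE; apply: derivable_big_sum => k.
exact: derivableM.
Qed.

Lemma derivable_addmx m n (A B : V -> 'M[R]_(m, n)) v x :
  derivable A x v -> derivable B x v -> derivable (fun y => A y + B y) x v.
Proof. exact: derivableD. Qed.

Lemma derivable_det n (A : V -> 'M[R]_n) v x :
  derivable A x v -> derivable (fun y => \det (A y)) x v.
Proof.
move=> /derivable_mxP dA; rewrite /determinant; apply: derivable_big_sum => s.
by apply: derivableM; [exact: derivable_cst|exact: derivable_big_prod].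
Qed.

Lemma derivable_adj n (A : V -> 'M[R]_n) v x :
  derivable A x v -> derivable (fun y => \adj (A y)) x v.
Proof.
move=> /derivable_mxP dA; apply/derivable_mxP => i j.
under eq_fun do rewrite mxE; apply: derivableM; first exact: derivable_cst.
apply: derivable_det; apply/derivable_mxP => k l.
by under eq_fun do rewrite !mxE; exact: dA.
Qed.

End MatrixDerivatives.

Section CurveDerivatives.
Context {R : realType}.

(** Stated for curves, because derivability in one direction yields continuity of the determinant
    only along that line. *)
Lemma derivable_invmx n (A : R -> 'M[R]_n) (x : R) :
  A x \in unitmx -> derivable A x 1 -> derivable (fun y => invmx (A y)) x 1.
Proof.
move=> uA dA; have ddet := derivable_det dA.
have d0 : \det (A x) != 0 by rewrite -unitfE -unitmxE.
pose B y := (\det (A y))^-1 *: \adj (A y).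
(* [invmx] returns its argument on singular matrices, so the adjugate formula holds only near x,
   where the determinant stays nonzero. *)
apply: (@near_eq_derivable _ _ _ B); last first.
  apply/derivable_mxP => i j; under eq_fun do rewrite mxE.
  apply: derivableM; first exact: derivableV.
  exact: (derivable_mxP _ _ _).1 (derivable_adj dA) i j.
have cdet := differentiable_continuous ((derivable1_diffP _ _).1 ddet).
near=> y; rewrite /B /invmx unitmxE unitfE ifT//.
by near: y; exact: cvgr_neq0 _ cdet d0.
Unshelve. all: by end_near. Qed.

Lemma is_derive_pair (V W1 W2 : normedModType R) (f : V -> W1) (g : V -> W2) v x df dg :
  is_derive x v f df -> is_derive x v g dg ->
  is_derive x v (fun y => (f y, g y)) (df, dg).
Proof.
move=> [df' <-] [dg' <-].
have H : (fun h => h^-1 *: (((fun y => (f y, g y)) \o shift x) (h *: v) - (f x, g x)))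
   @ 0^' --> ('D_v f x, 'D_v g x).
  exact: (cvg_pair df' dg').
apply: DeriveDef; first by apply/cvg_ex; exists ('D_v f x, 'D_v g x).
exact: cvg_lim H.
Qed.

Lemma is_derive_affine (W : normedModType R) (A B : W) :
  is_derive (0 : R) 1 (fun h : R => A + h *: B) B.
Proof.
have H : (fun h : R => h^-1 *: (((fun h : R => A + h *: B) \o shift 0) (h *: 1)
    - (A + 0 *: B))) @ 0^' --> B.
  apply: cvg_near_cst; near=> h.
  have h0 : h != 0 by near: h; exact: nbhs_dnbhs_neq.
  by rewrite /= addr0 [h *: 1]mulr1 scale0r addr0 addrC addKr scalerA mulVf// scale1r.
apply: DeriveDef; first by apply/cvg_ex; exists B.
exact: cvg_lim H.
Unshelve. all: by end_near. Qed.

(** Reduces a directional derivative to a curve through the point, the setting in which inverses and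
    positivity are controlled. *)
Lemma is_derive_curve (V W : normedModType R) (f : V -> W) v x df :
  is_derive (0 : R) 1 (fun h : R => f (h *: v + x)) df -> is_derive x v f df.
Proof.
suff E : (fun h : R => h^-1 *: ((f \o shift x) (h *: v) - f x)) =
  (fun h => h^-1 *: (((fun h : R => f (h *: v + x)) \o shift 0) (h *: 1) - f (0 *: v + x))).
  by move=> [d <-]; apply: DeriveDef; [apply/derivable1P|rewrite /derive E].
by apply/funext => h /=; rewrite addr0 scale0r add0r [_%:A]mulr1.
Qed.

(** Factoring s = y^{1/2} out on both sides turns y + h dy into 1 + h E. The quadratic form of E is
    at most K |w|^2 in absolute value, with K the sum of the absolute values of the entries, so |h|
    K < 1 suffices. *)
Lemma near_spd n (y dy : 'M[R]_n) : spd y -> dy^T = dy ->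
  \forall h \near (0 : R), spd (h *: dy + y).
Proof.
move=> sy dsym; have [[ssym spos] s2] := mxsqrtP sy.
set s := mxsqrt y in ssym spos s2; have us := spd_unitmx (conj ssym spos).
pose E := invmx s *m dy *m invmx s.
have EE : s *m E *m s = dy by rewrite /E -!mulmxA mulVmx// mulmx1 mulKVmx.
pose K := \sum_i \sum_j `|E i j|.
have K0 : 0 <= K by apply: sumr_ge0 => i _; exact: sumr_ge0.
(* K vanishes for dy = 0, so the bound on h is taken as the inverse of K + 1. *)
have K1 : 0 < K + 1 by lra.
near=> h.
have hK : `|h| * K < 1.
  have : `|h| < (K + 1)^-1.
    near: h; apply: (@pseudometric_normed_Zmodule.nbhs0_lt R R^o).
    by rewrite invr_gt0.
  move=> hlt; apply: (@le_lt_trans _ _ (`|h| * (K + 1))).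
    by rewrite ler_wpM2l// lerDl.
  by rewrite -ltr_pdivlMr// div1r.
have -> : h *: dy + y = s *m (h *: E + 1%:M) *m s^T.
  by rewrite mulmxDr mulmxDl mulmx1 ssym s2 -scalemxAr -scalemxAl EE.
apply: spd_congr => //; split=> [|w w0].
  rewrite trmxD trmx1 linearZ /= /E !trmx_mul trmx_inv ssym dsym.
  by rewrite mulmxA.
have wpos := rv_sqnorm_gt0 w0; set N := (w *m w^T) 0 0 in wpos.
have wij i j : `|w 0 i| * `|w 0 j| <= N.
  have le k : w 0 k ^+ 2 <= N.
    rewrite /N rv_sqnormE (bigD1 k)//= lerDl sumr_ge0// => l _; exact: sqr_ge0.
  have := le i; have := le j; rewrite -(real_normK (num_real (w 0 i))).
  rewrite -(real_normK (num_real (w 0 j))); move: (`|w 0 i|) (`|w 0 j|) => s1 s3; nra.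
have wE : `|(w *m E *m w^T) 0 0| <= K * N.
  rewrite mxE (le_trans (ler_norm_sum _ _ _))// /K exchange_big mulr_suml /=.
  apply: ler_sum => j _; rewrite normrM !mxE mulr_suml.
  apply: le_trans (ler_wpM2r (normr_ge0 _) (ler_norm_sum _ _ _)) _.
  rewrite mulr_suml; apply: ler_sum => k _.
  by rewrite normrM mulrAC mulrC ler_wpM2l.
have -> : (w *m (h *: E + 1%:M) *m w^T) 0 0 = h * (w *m E *m w^T) 0 0 + N.
  by rewrite mulmxDr mulmx1 mulmxDl -scalemxAr -scalemxAl addmxE scalemxE.
have : `|h * (w *m E *m w^T) 0 0| < N.
  rewrite normrM; apply: le_lt_trans (ler_wpM2l (normr_ge0 h) wE) _.
  by rewrite mulrA gtr_pMl.
by rewrite ltr_norml => /andP[+ _]; lra.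
Unshelve. all: by end_near. Qed.

End CurveDerivatives.

(** * Derivability of the action along lines *)

Section Invariance.
Context {R : realType} {n : nat}.
Implicit Types (g : jacobi R n) (m w : @ext_coords R n).

Lemma near_ext_domain m w : ext_domain m -> ext_tangent w ->
  \forall h \near (0 : R), ext_domain (h *: w + m).
Proof.
move: m w => [[[[x y] p] q] k] [[[[dx dy] dp] dq] dk] [xsym sy] [dxsym dysym].
have := near_spd sy dysym; apply: filterS => h sh; split=> //.
by rewrite trmxD linearZ /= dxsym xsym.
Qed.

Lemma derivable_real_num (a b c d : 'M[R]_n) (X Y : R -> 'M[R]_n) (t : R) :
  Y t \in unitmx -> derivable X t 1 -> derivable Y t 1 ->
  derivable (fun h => real_num a b c d (X h) (Y h)) t 1.
Proof.
move=> uY dX dY; have dZ := derivable_invmx uY dY.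
have cM (A : 'M[R]_n) : derivable (fun _ : R => A) t 1 by exact: derivable_cst.
have dXZ := derivable_mulmx dX dZ.
have dK := derivable_addmx dY (derivable_mulmx dXZ dX).
have d1 := derivable_mulmx (derivable_mulmx (cM c) dK) (cM a^T).
have d2 := derivable_mulmx (derivable_mulmx (derivable_mulmx (cM c) dX) dZ) (cM b^T).
have d3 := derivable_mulmx (derivable_mulmx (derivable_mulmx (cM d) dZ) dX) (cM a^T).
have d4 := derivable_mulmx (derivable_mulmx (cM d) dZ) (cM b^T).
exact: (derivable_addmx (derivable_addmx (derivable_addmx d1 d2) d3) d4).
Qed.

Lemma derivable_real_den (c d : 'M[R]_n) (X Y : R -> 'M[R]_n) (t : R) :
  Y t \in unitmx -> derivable X t 1 -> derivable Y t 1 ->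
  derivable (fun h => real_den c d (X h) (Y h)) t 1.
Proof.
move=> uY dX dY; have dZ := derivable_invmx uY dY.
have cM (A : 'M[R]_n) : derivable (fun _ : R => A) t 1 by exact: derivable_cst.
have dXZ := derivable_mulmx dX dZ.
have dK := derivable_addmx dY (derivable_mulmx dXZ dX).
have d1 := derivable_mulmx (derivable_mulmx (cM c) dK) (cM c^T).
have d2 := derivable_mulmx (derivable_mulmx (cM d) dZ) (cM d^T).
have d3 := derivable_mulmx (derivable_mulmx (derivable_mulmx (cM c) dX) dZ) (cM d^T).
have d4 := derivable_mulmx (derivable_mulmx (derivable_mulmx (cM d) dZ) dX) (cM c^T).
exact: (derivable_addmx (derivable_addmx (derivable_addmx d1 d2) d3) d4).
Qed.

End Invariance.

(** * Invariance of the one-form *)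

Section LambdaR.
Context {R : realType} {n : nat}.
Implicit Types (g : jacobi R n) (m w : @ext_coords R n).

Lemma lambdaRE (x y dx dy : 'M[R]_n) (p q dp dq : 'rV[R]_n) (k dk : R) :
  lambdaR (x, y, p, q, k) (dx, dy, dp, dq, dk) =
  dk - sform (row_mx p q) (row_mx dp dq).
Proof. by rewrite sformE opprB addrA addrAC. Qed.

(** The derivatives X, Y of the x and y components stay existential, since [lambdaR] contains no dx
    or dy; the other components are affine along the line, so their derivatives are explicit. *)
Lemma is_derive_ext_map g m w : GJ g -> ext_domain m ->
  let: (_, _, dp, dq, dk) := w in
  let B := row_mx dp dq *m invmx (jM g) in
  exists X Y : 'M[R]_n, is_derive (0 : R) 1 (fun h : R => ext_map g (h *: w + m))
    (X, Y, lsubmx B, rsubmx B, dk + sform (jrow g) (row_mx dp dq)).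
Proof.
move: m w => [[[[x y] p] q] k] [[[[dx dy] dp] dq] dk] sg dm B.
pose a := ulsubmx (jM g); pose b := ursubmx (jM g).
pose c := dlsubmx (jM g); pose d := drsubmx (jM g).
have [xsym sy] := dm.
have dl (W : normedModType R) (A C : W) : derivable (fun h : R => h *: A + C) (0 : R) 1.
  by under eq_fun do rewrite addrC; have [] := is_derive_affine C A.
have sM : symplectic (block_mx a b c d) by rewrite submxK.
have [uD _] := siegel_act_real sM ((siegelP x y).2 dm).
pose Xh (h : R) := h *: dx + x; pose Yh (h : R) := h *: dy + y.
have uY : 0 *: dy + y \in unitmx by rewrite scale0r add0r spd_unitmx.
have dD := @derivable_real_den R n c d Xh Yh 0 uY (dl _ dx x) (dl _ dy y).
have dN := @derivable_real_num R n a b c d Xh Yh 0 uY (dl _ dx x) (dl _ dy y).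
have dDi : derivable (fun h : R => invmx (real_den c d (h *: dx + x) (h *: dy + y))) 0 1.
  by apply: (derivable_invmx _ dD); rewrite /Xh /Yh !scale0r !add0r.
have dX := derivable_mulmx dDi dN.
pose w0 := jpq g + row_mx p q *m invmx (jM g).
have wE (h : R) : jpq g + row_mx (h *: dp + p) (h *: dq + q) *m invmx (jM g) = w0 + h *: B.
  by rewrite -add_row_mx -scale_row_mx mulmxDl -scalemxAl addrCA addrC /w0.
have kE (h : R) : jkappa g + (h *: dk + k) + sform (jrow g) (row_mx (h *: dp + p) (h *: dq + q))
    = jkappa g + k + sform (jrow g) (row_mx p q)
      + h *: (dk + sform (jrow g) (row_mx dp dq)).
  have -> : row_mx (h *: dp + p) (h *: dq + q) = h *: row_mx dp dq + row_mx p q.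
    by rewrite -add_row_mx -scale_row_mx.
  rewrite sformDr.
  have -> : sform (jrow g) (h *: row_mx dp dq) = h * sform (jrow g) (row_mx dp dq).
    by rewrite /sform linearZ /= -scalemxAr scalemxE.
  by rewrite /GRing.scale /=; ring.
exists ('D_1 (fun h : R => invmx (real_den c d (h *: dx + x) (h *: dy + y)) *m
             real_num a b c d (h *: dx + x) (h *: dy + y)) 0),
  ('D_1 (fun h : R => invmx (real_den c d (h *: dx + x) (h *: dy + y))) 0).
have := is_derive_pair (is_derive_pair (is_derive_pair (is_derive_pair
  (derivableP dX) (derivableP dDi)) (is_derive_affine (lsubmx w0) (lsubmx B)))
  (is_derive_affine (rsubmx w0) (rsubmx B)))
  (is_derive_affine (jkappa g + k + sform (jrow g) (row_mx p q))
     (dk + sform (jrow g) (row_mx dp dq))).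
congr (is_derive _ _ _ _); apply/funext => h.
have -> : h *: ((dx, dy, dp, dq, dk) : ext_coords) + (x, y, p, q, k) =
  (h *: dx + x, h *: dy + y, h *: dp + p, h *: dq + q, h *: dk + k) by [].
by rewrite /ext_map wE kE !linearD !linearZ.
Qed.

Lemma lambdaR_invariant g : GJ g -> invariant_form lambdaR (extSJ_map g).
Proof.
move=> sg m w dm tw.
have := @is_derive_ext_map g m w sg dm.
move: w tw => [[[[dx dy] dp] dq] dk] tw [X [Y D]].
set w : ext_coords := (dx, dy, dp, dq, dk) in tw D *.
(* [extSJ_map] is a choice identified with [ext_map] only on the domain; a line in a tangent
   direction stays there for small h. *)
have near_eq : \forall h \near (0 : R), ext_map g (h *: w + m) = extSJ_map g (h *: w + m).
  by apply: filterS (near_ext_domain dm tw) => h dh; rewrite extSJ_mapE.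
have [dmap ->] := is_derive_curve (near_eq_is_derive near_eq D).
split=> //; rewrite extSJ_mapE//.
move: m dm {D near_eq dmap} => [[[[x y] p] q] k] dm.
rewrite /ext_map !lambdaRE !hsubmxK.
(* The amount sform((lambda, mu), (dp, dq)) gained by d kappa equals the pairing of (lambda, mu)
   M^-1 with (dp, dq) M^-1, which is subtracted through the shift of (p, q); the two cancel. *)
have S u : sform (u *m invmx (jM g)) (row_mx dp dq *m invmx (jM g)) = sform u (row_mx dp dq).
  by rewrite -(sform_symplectic _ _ sg) !mulmxKV// symplectic_unitmx.
by rewrite sformDl /jpq !S; ring.
Qed.

End LambdaR.

(** With s^2 = y, [iw_ptM] gives b' = x d' - y c' and a' = x c' + y d' for the top row of N, so the
    right sides are the entries c b' + d d' and c a' + d c' of the bottom row of M N. *)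
Lemma mulmx_bottom_row (F : comPzRingType) n (c d x s c' d' : 'M[F]_n) :
  (c *m x + d) *m d' - c *m s *m (s *m c') =
    c *m (x *m d' - s *m s *m c') + d *m d' /\
  c *m s *m (s *m d') + (c *m x + d) *m c' =
    c *m (x *m c' + s *m s *m d') + d *m c'.
Proof. by split; rewrite !(mulmxN, mulmxDr, mulmxDl, mulmxA); mxabel. Qed.

(** * The actions for a fixed group element in block form *)

Section Actions.
Context {R : realType} {n : nat}.
Context (a b c d : 'M[R]_n) (l r : 'rV[R]_n) (k : R).
Context (sM : symplectic (block_mx a b c d)).
Let M := block_mx a b c d.
Let g := Jacobi M l r k.

Let sg : GJ g. Proof. exact: sM. Qed.

Lemma row_mx_invmxE (p q : 'rV[R]_n) : row_mx p q *m invmx (block_mx a b c d) =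
  row_mx (p *m d^T - q *m c^T) (- (p *m b^T) + q *m a^T).
Proof. by rewrite symplectic_invmx_block// mul_row_block !mulmxN. Qed.

Lemma jp_block : jp g = l *m d^T - r *m c^T.
Proof. by rewrite /jp /= row_mx_invmxE row_mxKl. Qed.

Lemma jq_block : jq g = - (l *m b^T) + r *m a^T.
Proof. by rewrite /jq /= row_mx_invmxE row_mxKr. Qed.

Lemma jpq_add_rowE (p q : 'rV[R]_n) : row_mx (jp g) (jq g) + row_mx p q *m invmx M =
  row_mx (jp g + p *m d^T - q *m c^T) (jq g - p *m b^T + q *m a^T).
Proof. by rewrite row_mx_invmxE add_row_mx !addrA. Qed.

Lemma row_mul_block : row_mx l r = row_mx (jp g) (jq g) *m M.
Proof. by rewrite -jpqE /jpq mulmxKV// symplectic_unitmx. Qed.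

Lemma SJ_action0E v u v1 u1 : siegel v ->
  SJ_action0 M l r (v, u) (v1, u1) <->
  v1 = siegel_act a b c d v /\ u1 = (u + toC l *m v + toC r) *m invmx (toC c *m v + toC d).
Proof.
move=> sv; have [x [y [vE xsym sy]]] := sv; have uy := spd_unitmx sy.
have [p [q E]] := SJ_chart_surj x u uy.
have [h sh [hx hy hp hq _]] := @jcoords_surj R n (x, y, p, q, 0) (conj xsym sy).
have hE : (v, u) = SJ_point h by rewrite vE -E /SJ_point hx hy hp hq.
have hv : iw_pt (jM h) = v by rewrite /iw_pt hx hy.
rewrite hE (SJ_action0P l r (v1, u1) sM sh) (SJ_point_mulJ sM sh) hv -hE.
by split=> [[-> ->]|[-> ->]].
Qed.

Lemma SJ_action0_chart x y p q x1 y1 p1 q1 : siegel (cplx x y) ->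
  SJ_action0 M l r (SJ_chart x y p q) (SJ_chart x1 y1 p1 q1) <->
  cplx x1 y1 = siegel_act a b c d (cplx x y) /\
  row_mx p1 q1 = row_mx (jp g) (jq g) + row_mx p q *m invmx M.
Proof.
move=> sv; have [h sh [hx hy hp hq _]] := @jcoords_surj R n (x, y, p, q, 0) ((siegelP x y).1 sv).
have hE : SJ_chart x y p q = SJ_point h by rewrite /SJ_point hx hy hp hq.
have hv : iw_pt (jM h) = cplx x y by rewrite /iw_pt hx hy.
rewrite hE (SJ_action0P l r _ sM sh) -hv -(iw_pt_mul sM sh).
pose g0 := Jacobi M l r 0; have sgh : GJ (mulJ g0 h) by exact: (@GJ_mulJ R n g0 h).
have := @jpq_mulJ R n g0 h sM sh; rewrite !jpqE hp hq => <-.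
split=> [e|[/cplx_inj[-> ->] /eq_row_mx[-> ->]]//].
by have [<- <- <- <-] := SJ_chart_inj (spd_unitmx (spd_iw_y sgh)) (esym e).
Qed.

Lemma extSJ_action_chart x y p q k' x1 y1 p1 q1 k1 : siegel (cplx x y) ->
  extSJ_action g (extSJ_chart (x, y, p, q, k')) (extSJ_chart (x1, y1, p1, q1, k1)) <->
  [/\ cplx x1 y1 = siegel_act a b c d (cplx x y),
      p1 = jp g + p *m d^T - q *m c^T, q1 = jq g - p *m b^T + q *m a^T &
      k1 = k + k' + (l *m q^T) 0 0 - (r *m p^T) 0 0].
Proof.
move=> sv; have dm : ext_domain (x, y, p, q, k') := (siegelP x y).1 sv.
rewrite (extSJ_actionP _ sg dm).
have kE : k + k' + sform (row_mx l r) (row_mx p q) =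
  k + k' + (l *m q^T) 0 0 - (r *m p^T) 0 0 by rewrite sformE addrA.
have vE := siegel_act_parts sM sv.
have mE : ext_map g (x, y, p, q, k') =
    (invmx (real_den c d x y) *m real_num a b c d x y, invmx (real_den c d x y),
     jp g + p *m d^T - q *m c^T, jq g - p *m b^T + q *m a^T,
     k + k' + (l *m q^T) 0 0 - (r *m p^T) 0 0).
  rewrite /ext_map jpqE jpq_add_rowE row_mxKl row_mxKr -kE /= /jrow /=.
  by rewrite block_mxKul block_mxKur block_mxKdl block_mxKdr.
have := ext_map_domain sg dm; rewrite mE => dm1.
split=> [/esym/(extSJ_chart_inj dm1)[<- <- <- <- <-]//|[]].
by rewrite vE => /cplx_inj[-> ->] -> -> ->.
Qed.

Lemma extSJ_actionE x y p q k' v1 u1 k1 : siegel (cplx x y) ->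
  let v := cplx x y in let u := toC p *m v + toC q in
  extSJ_action g (v, u, k') (v1, u1, k1) <->
  [/\ v1 = siegel_act a b c d v,
      u1 = (u + toC l *m v + toC r) *m invmx (toC c *m v + toC d) &
      k1 = k + k' + (l *m q^T) 0 0 - (r *m p^T) 0 0].
Proof.
move=> sv v u; have dm : ext_domain (x, y, p, q, k') := (siegelP x y).1 sv.
have [h sh hE] := jcoords_surj dm; have [hx hy hp hq hk] := hE.
have := @extSJ_action_jcoords R n g h (v1, u1, k1) sg sh.
rewrite hE => ->; rewrite -extSJ_pointE /extSJ_point (SJ_point_mulJ sM sh).
have -> : iw_pt (jM h) = v by rewrite /iw_pt hx hy.
have -> : (SJ_point h).2 = u by rewrite /SJ_point hx hy hp hq.
rewrite jkappa_mulJ_pq// hk jpqE hp hq sformE addrA.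
by split=> [[-> -> ->]|[-> -> ->]].
Qed.

Lemma iw_XY_mul (N : 'M[R]_(n + n)) : symplectic N ->
  let x := iw_x N in let y := iw_y N in let X := iw_X N in let Y := iw_Y N in
  let s := mxsqrt y in
  cplx (iw_X (M *m N)) (- iw_Y (M *m N)) = toC (mxsqrt (iw_y (M *m N))) *m
    (toC ((c *m x + d) *m invmx s *m X + c *m s *m Y)
     + 'i%C *: toC (c *m s *m X - (c *m x + d) *m invmx s *m Y)).
Proof.
move=> sN x y X Y s; have sy := spd_iw_y sN.
have [ss s2] := mxsqrtP sy; have us := spd_unitmx ss.
rewrite -/s -/y in ss s2 us.
have := sN; rewrite -[N]submxK => /iw_ptM; rewrite submxK cplxM -/x -/y => /cplx_inj[bE aE].
rewrite -cplxE toCE cplxM !mul0mx subr0 addr0 /iw_X /iw_Y opprK.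
have -> : drsubmx (M *m N) = c *m ursubmx N + d *m drsubmx N.
  by rewrite -{1}[N]submxK mulmx_block block_mxKdr.
have -> : dlsubmx (M *m N) = c *m ulsubmx N + d *m dlsubmx N.
  by rewrite -{1}[N]submxK mulmx_block block_mxKdl.
have [e1 e2] := mulmx_bottom_row c d x s (dlsubmx N) (drsubmx N).
(* X = s d' and Y = -s c' by definition, so s^-1 X and s^-1 Y give back the bottom row of N. *)
rewrite -bE -aE -s2 -e1 -e2 /X /Y /iw_X /iw_Y -/y -/s !mulmxN opprK.
by rewrite -2!(mulmxA _ (invmx s)) !(mulKmx us).
Qed.

End Actions.

Theorem lemma8 (R : realType) (n : nat) (a b c d : 'M[R]_n)
    (lambda mu : 'rV[R]_n) (kappa : R)
    (hM : symplectic (block_mx a b c d)) :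
  let M : 'M[R]_(n + n) := block_mx a b c d in
  let g := Jacobi M lambda mu kappa in
  let i : R[i] := 'i%C in
  let aC := toC a in let bC := toC b in let cC := toC c in let dC := toC d in
  let V1 (v' : 'M[R[i]]_n) : 'M[R[i]]_n := (aC *m v' + bC) *m invmx (cC *m v' + dC) in
  let U1 (v' : 'M[R[i]]_n) (u' : 'rV[R[i]]_n) : 'rV[R[i]]_n :=
    (u' + toC lambda *m v' + toC mu) *m invmx (cC *m v' + dC) in
  let p : 'rV[R]_n := jp g in
  let q : 'rV[R]_n := jq g in
  [/\ (* a *)
      forall v' u', siegel v' ->
        [/\ cC *m v' + dC \in unitmx,
            siegel (V1 v'),
            (forall v1 u1, SJ_action0 M lambda mu (v', u') (v1, u1) <->
                           v1 = V1 v' /\ u1 = U1 v' u'),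
            v' *m cC^T + dC^T \in unitmx /\
            V1 v' = invmx (v' *m cC^T + dC^T) *m (v' *m aC^T + bC^T) &
            forall x' y' : 'M[R]_n, v' = cplx x' y' ->
              let yi : 'M[R]_n := invmx y' in
              let D : 'M[R]_n := c *m (y' + x' *m yi *m x') *m c^T + d *m yi *m d^T
                       + c *m x' *m yi *m d^T + d *m yi *m x' *m c^T in
              let N : 'M[R]_n := c *m (y' + x' *m yi *m x') *m a^T + c *m x' *m yi *m b^T
                       + d *m yi *m x' *m a^T + d *m yi *m b^T in
              let vb : 'M[R[i]]_n := cconjmx v' in
              let B : 'M[R[i]]_n := 2%:R *: (vb *m aC^T *m cC *m v')
                       + vb *m (cC^T *m bC + aC^T *m dC)
                       + (bC^T *m cC + dC^T *m aC) *m v'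
                       + 2%:R *: (bC^T *m dC) in
              [/\ y' \in unitmx, D \in unitmx,
                  V1 v' = invmx (toC D) *m (toC N + i%:M),
                  vb *m cC^T + dC^T \in unitmx &
                  V1 v' = invmx (vb *m cC^T + dC^T)
                          *m (2%:R^-1 *: B + i *: toC y')
                          *m invmx (cC *m v' + dC)]],
      (* b *)
      [/\ M \in unitmx /\ row_mx p q = row_mx lambda mu *m invmx M,
          p = lambda *m d^T - mu *m c^T /\ q = - (lambda *m b^T) + mu *m a^T,
          row_mx lambda mu = row_mx p q *m M,
          lambda = p *m a + q *m c /\ mu = p *m b + q *m d &
          forall (x' y' : 'M[R]_n) (p' q' : 'rV[R]_n), siegel (cplx x' y') ->
            row_mx p q + row_mx p' q' *m invmx M
              = row_mx (p + p' *m d^T - q' *m c^T) (q - p' *m b^T + q' *m a^T)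
            /\ forall (x1 y1 : 'M[R]_n) (p1 q1 : 'rV[R]_n),
               SJ_action0 M lambda mu
                 (SJ_chart x' y' p' q') (SJ_chart x1 y1 p1 q1) <->
               cplx x1 y1 = V1 (cplx x' y') /\
               row_mx p1 q1 = row_mx p q + row_mx p' q' *m invmx M],
      (* c *)
      forall (x' y' : 'M[R]_n) (p' q' : 'rV[R]_n) (kappa' : R),
        siegel (cplx x' y') ->
        let v' : 'M[R[i]]_n := cplx x' y' in
        let k1 : R := kappa + kappa' + (lambda *m q'^T) 0 0 - (mu *m p'^T) 0 0 in
        (forall u' : 'rV[R[i]]_n, u' = toC p' *m v' + toC q' ->
         forall v1 u1 kappa1,
           extSJ_action g (v', u', kappa') (v1, u1, kappa1) <->
           [/\ v1 = V1 v', u1 = U1 v' u' & kappa1 = k1]) /\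
        (forall (x1 y1 : 'M[R]_n) (p1 q1 : 'rV[R]_n) (kappa1 : R),
           extSJ_action g (extSJ_chart (x', y', p', q', kappa'))
                          (extSJ_chart (x1, y1, p1, q1, kappa1)) <->
           [/\ cplx x1 y1 = V1 v',
               p1 = p + p' *m d^T - q' *m c^T,
               q1 = q - p' *m b^T + q' *m a^T &
               kappa1 = k1]),
      (* d *)
      invariant_form lambdaR (extSJ_map g) &
      (* e *)
      forall g', GJ g' ->
      forall x' y' X' Y' p' q' kappa' x1 y1 X1 Y1 p1 q1 kappa1,
        Sn_coords g' = (x', y', X', Y', p', q', kappa') ->
        Sn_coords (mulJ g g') = (x1, y1, X1, Y1, p1, q1, kappa1) ->
        let s' : 'M[R]_n := mxsqrt y' in
        [/\ cplx X1 (- Y1) =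
              toC (mxsqrt y1) *m
              (toC ((c *m x' + d) *m invmx s' *m X' + c *m s' *m Y')
               + i *: toC (c *m s' *m X' - (c *m x' + d) *m invmx s' *m Y')),
            cplx x1 y1 = V1 (cplx x' y'),
            p1 = p + p' *m d^T - q' *m c^T,
            q1 = q - p' *m b^T + q' *m a^T &
            kappa1 = kappa + kappa' + (lambda *m q'^T) 0 0
                     - (mu *m p'^T) 0 0]].
Proof.
move=> M g i aC bC cC dC V1 U1 p q.
have sg : GJ g by exact: hM.
split.
- move=> v' u' sv; split.
  + exact: automorphy_unitmx hM sv.
  + exact: siegel_siegel_act hM sv.
  + by move=> v1 u1; exact: (SJ_action0E lambda mu hM u' v1 u1 sv).
  + by split; [exact: automorphy_tr_unitmx hM sv|exact: siegel_act_tr hM sv].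
  + move=> x' y' vE; rewrite vE in sv *; move=> yi D N vb B.
    have [_ sy] := (siegelP _ _).1 sv.
    have [uD vD] := siegel_act_real hM sv; split.
    * exact: spd_unitmx.
    * exact: uD.
    * exact: vD.
    * exact: automorphy_conj_unitmx hM sv.
    * exact: siegel_act_conjE hM sv.
- split.
  + by split; [exact: symplectic_unitmx|exact: (esym (jpqE g))].
  + by split; [exact: jp_block|exact: jq_block].
  + exact: row_mul_block.
  + have := row_mul_block lambda mu kappa hM.
    by rewrite mul_row_block => /eq_row_mx.
  + move=> x' y' p' q' sv; split; first exact: jpq_add_rowE.
    by move=> x1 y1 p1 q1; exact: SJ_action0_chart.
- move=> x' y' p' q' kappa' sv v' k1; split.
  + by move=> u' -> v1 u1 kappa1; exact: extSJ_actionE.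
  + by move=> x1 y1 p1 q1 kappa1; exact: extSJ_action_chart.
- exact: lambdaR_invariant.
- move=> g' sg' x' y' X' Y' p' q' kappa' x1 y1 X1 Y1 p1 q1 kappa1.
  move=> [<- <- <- <- <- <- <-] [<- <- <- <- <- <- <-] s'.
  (* Apart from X and Y, the S_n-coordinates of g g' are those of its coset, so their formulas are
     an instance of c) at the coset of g'. *)
  have A := (@extSJ_action_jcoords R n g g' _ sg sg').2 erefl.
  have [vE pE qE kE] := (@extSJ_action_chart R n a b c d lambda mu kappa hM
    _ _ _ _ _ _ _ _ _ _ (siegel_iw_pt sg')).1 A.
  split; [|exact: vE|exact: pE|exact: qE|exact: kE].
  exact: (iw_XY_mul a b c d sg').
Qed.
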